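(* Let $n \geq 2$. Let $\mathcal{F}$ be a collection of isomorphism classes of indecomposable, finitely presentable $n$-parameter persistence modules. In the space of finitely presentable $n$-parameter persistence modules with the interleaving distance, the interior of the closure of the set of $\mathcal{F}$-decomposable modules is equal to the interior of the closure of $\mathcal{F}$. In particular, if the $\mathcal{F}$-decomposable modules are dense, then the set $\mathcal{F}$ must itself be dense.
   Context: Fix a field $\mathbb{k}$ and let $\mathbf{vec}$ be the category of finite dimensional $\mathbb{k}$-vector spaces. $\mathbf{R}^n$ is the poset $\mathbb{R}^n$ with the product (componentwise) order, viewed as a category. An $n$-parameter persistence module is a functor $M : \mathbf{R}^n \to \mathbf{vec}$; morphisms are natural transformations. For $i \in \mathbf{R}^n$, let $\mathsf{P}_i : \mathbf{R}^n \to \mathbf{vec}$ be the functor with $\mathsf{P}_i(j) = \mathbb{k}$ if $i \leq j$ and $0$ otherwise, all structure morphisms not forced to be zero being the identity. A module is finitely presentable if it is isomorphic to the cokernel of a morphism $\bigoplus_{j \in J} \mathsf{P}_j \to \bigoplus_{i \in I} \mathsf{P}_i$ with $I, J$ finite multisets of elements of $\mathbf{R}^n$. A module is decomposable if it is isomorphic to $A \oplus B$ with $A, B$ both non-zero; it is indecomposable if it is non-zero and not decomposable. A finitely presentable module is $\mathcal{F}$-decomposable if it is isomorphic to a direct sum of modules whose isomorphism classes belong to $\mathcal{F}$. Interleavings: for $r \in \mathbb{R}$ and $s \in \mathbf{R}^n$, $s + r$ denotes $(s_1+r,\dots,s_n+r)$. The shift $M[r]$ is defined by $M[r](s) = M(s+r)$,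 with the corresponding structure morphisms (and similarly $f[r]$ for morphisms $f$). For $r \geq 0$, $\eta^M_r : M \to M[r]$ is the natural transformation given by the structure morphisms $M(a) \to M(a+r)$. For $\epsilon \geq 0$, an $\epsilon$-interleaving between $M$ and $N$ is a pair of morphisms $f : M \to N[\epsilon]$, $g : N \to M[\epsilon]$ with $g[\epsilon]\circ f = \eta^M_{2\epsilon}$ and $f[\epsilon] \circ g = \eta^N_{2\epsilon}$. The interleaving distance is $d_I(M,N) = \inf\{\epsilon \geq 0 : M \text{ and } N \text{ are } \epsilon\text{-interleaved}\} \in [0,\infty]$. The space of finitely presentable $n$-parameter persistence modules is the set of isomorphism classes of finitely presentable modules $\mathbf{R}^n \to \mathbf{vec}$, with the topology generated by the open balls of $d_I$ (which is an extended metric on this set). *)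

(* Defs.v *)
From HB Require Import structures.
From mathcomp Require Import all_boot all_order all_algebra.
From mathcomp Require Import generic_quotient.
From mathcomp Require Import all_classical all_reals all_analysis.

Set Implicit Arguments.
Unset Strict Implicit.
Unset Printing Implicit Defensive.
Import Order.TTheory GRing.Theory Num.Theory.
Local Open Scope classical_set_scope.
Local Open Scope ring_scope.
Local Open Scope quotient_scope.

Section PersistenceModules.
Variables (k : fieldType) (R : realType) (n : nat).
Implicit Types (a b c : 'rV[R]_n) (r e : R).

Definition lev a b : bool := [forall i, a 0 i <= b 0 i].

Lemma levP a b : reflect (forall i, a 0 i <= b 0 i) (lev a b).
Proof. exact: forallP. Qed.

Lemma lev_refl a : lev a a. Proof. by apply/levP. Qed.

Lemma lev_trans b a c : lev a b -> lev b c -> lev a c.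
Proof.
by move=> /levP ab /levP bc; apply/levP => i; exact: le_trans (ab i) (bc i).
Qed.

Definition translate a r : 'rV[R]_n := a + const_mx r.

Lemma lev_translate r a b : lev a b -> lev (translate a r) (translate b r).
Proof. by move=> /levP ab; apply/levP => i; rewrite !mxE lerD2r. Qed.

Lemma translateD a r e : translate (translate a r) e = translate a (r + e).
Proof. by apply/rowP => i; rewrite !mxE addrA. Qed.

Lemma lev_translater a r : 0 <= r -> lev a (translate a r).
Proof. by move=> r0; apply/levP => i; rewrite !mxE lerDl. Qed.

Record pmod := PMod {
  pm_obj :> 'rV[R]_n -> vectType k;
  pm_map : forall a b, lev a b -> 'Hom(pm_obj a, pm_obj b);
  pm_map_id : forall a (h : lev a a) x, pm_map h x = x;
  pm_map_comp : forall a b c (ab : lev a b) (bc : lev b c) (ac : lev a c) x,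
    pm_map bc (pm_map ab x) = pm_map ac x }.

Record pm_hom (M N : pmod) := PMHom {
  pm_fun :> forall a, 'Hom(M a, N a);
  pm_nat : forall a b (ab : lev a b) x,
    pm_fun b (pm_map M ab x) = pm_map N ab (pm_fun a x) }.

Definition pm_eq (M N : pmod) (f g : pm_hom M N) : Prop :=
  forall a, f a =1 g a.

Lemma pm_id_nat (M : pmod) a b (ab : lev a b) x :
  (\1%VF : 'End(M b)) (pm_map M ab x) = pm_map M ab ((\1%VF : 'End(M a)) x).
Proof. by rewrite !id_lfunE. Qed.

Definition pm_id (M : pmod) : pm_hom M M :=
  @PMHom M M (fun=> \1%VF) (@pm_id_nat M).

Lemma pm_comp_nat (L M N : pmod) (g : pm_hom M N) (f : pm_hom L M)
    a b (ab : lev a b) x :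
  (g b \o f b)%VF (pm_map L ab x) = pm_map N ab ((g a \o f a)%VF x).
Proof. by rewrite !comp_lfunE !pm_nat. Qed.

Definition pm_comp (L M N : pmod) (g : pm_hom M N) (f : pm_hom L M) :
    pm_hom L N :=
  @PMHom L N (fun a => g a \o f a)%VF (pm_comp_nat g f).

Definition pm_iso (M N : pmod) : Prop :=
  exists (f : pm_hom M N) (g : pm_hom N M),
    pm_eq (pm_comp g f) (pm_id M) /\ pm_eq (pm_comp f g) (pm_id N).

Lemma pm_zero_map_id a (h : lev a a) (x : 'rV[k]_0) :
  (0 : 'Hom('rV[k]_0, 'rV[k]_0)) x = x.
Proof. by rewrite [LHS]thinmx0 [RHS]thinmx0. Qed.

Lemma pm_zero_map_comp a b c (ab : lev a b) (bc : lev b c) (ac : lev a c)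
    (x : 'rV[k]_0) :
  (0 : 'Hom('rV[k]_0, 'rV[k]_0)) ((0 : 'Hom('rV[k]_0, 'rV[k]_0)) x) =
  (0 : 'Hom('rV[k]_0, 'rV[k]_0)) x.
Proof. by rewrite [LHS]thinmx0 [RHS]thinmx0. Qed.

Definition pm_zero : pmod :=
  @PMod (fun=> 'rV[k]_0) (fun _ _ _ => 0) pm_zero_map_id pm_zero_map_comp.

Section BinarySum.
Variables M N : pmod.

Definition pm_add_fun a b (ab : lev a b) (x : M a * N a) : M b * N b :=
  (pm_map M ab x.1, pm_map N ab x.2).

Lemma pm_add_fun_linear a b (ab : lev a b) : linear (pm_add_fun ab).
Proof. by move=> c x y; rewrite /pm_add_fun /= !linearP. Qed.

HB.instance Definition _ a b (ab : lev a b) :=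
  GRing.isLinear.Build k (M a * N a)%type (M b * N b)%type _ _
    (pm_add_fun_linear ab).

Lemma pm_add_map_id a (h : lev a a) (x : M a * N a) :
  linfun (pm_add_fun h) x = x.
Proof. by rewrite lfunE /= /pm_add_fun !pm_map_id; case: x. Qed.

Lemma pm_add_map_comp a b c (ab : lev a b) (bc : lev b c) (ac : lev a c)
    (x : M a * N a) :
  linfun (pm_add_fun bc) (linfun (pm_add_fun ab) x) = linfun (pm_add_fun ac) x.
Proof. by rewrite !lfunE /= /pm_add_fun /= !(pm_map_comp ab bc ac). Qed.

Definition pm_add : pmod :=
  @PMod (fun a => (M a * N a)%type : vectType k)
    (fun a b ab => linfun (pm_add_fun ab)) pm_add_map_id pm_add_map_comp.

End BinarySum.

Definition pm_sum (s : seq pmod) : pmod := foldr pm_add pm_zero s.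

(* The dimension of 'rV[k]_(lev i a) is 1 if i <= a and 0 otherwise; the 1 x 1
   instance of const_mx 1 is the identity matrix. *)
Section Free.
Variable i : 'rV[R]_n.

Definition pm_free_map a b : 'Hom('rV[k]_(lev i a), 'rV[k]_(lev i b)) :=
  linfun (mulmxr (const_mx 1 : 'M[k]_(lev i a, lev i b))).

Lemma pm_free_map_id a (h : lev a a) (x : 'rV[k]_(lev i a)) :
  pm_free_map a a x = x.
Proof.
rewrite /pm_free_map lfunE /=; move: x.
case: (lev i a) => x; last by rewrite [LHS]thinmx0 [RHS]thinmx0.
by apply/rowP => j; rewrite mxE big_ord1 mxE mulr1 !ord1.
Qed.

Lemma pm_free_map_comp a b c (ab : lev a b) (bc : lev b c) (ac : lev a c)
    (x : 'rV[k]_(lev i a)) :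
  pm_free_map b c (pm_free_map a b x) = pm_free_map a c x.
Proof.
rewrite /pm_free_map !lfunE /= -mulmxA; congr (_ *m _).
have [ia|_] := boolP (lev i a); last by apply/matrixP => -[].
rewrite (lev_trans ia ab).
by apply/matrixP => p q; rewrite mxE big_ord1 !mxE mulr1.
Qed.

Definition pm_free : pmod :=
  @PMod (fun a => 'rV[k]_(lev i a)) (fun a b _ => pm_free_map a b)
    pm_free_map_id pm_free_map_comp.

End Free.

Definition is_cokernel (L M C : pmod) (phi : pm_hom L M) (pi : pm_hom M C) :
    Prop :=
  (forall a x, pm_comp pi phi a x = 0) /\
  forall (N : pmod) (g : pm_hom M N), (forall a x, pm_comp g phi a x = 0) ->
    exists h : pm_hom C N, pm_eq (pm_comp h pi) g /\
      forall h' : pm_hom C N, pm_eq (pm_comp h' pi) g -> pm_eq h' h.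

(* Cokernels are only defined up to isomorphism, so being isomorphic to a
   cokernel of phi is the same as carrying a map that is a cokernel of phi. *)
Definition finpres (M : pmod) : Prop :=
  exists (I J : seq 'rV[R]_n)
    (phi : pm_hom (pm_sum (map pm_free J)) (pm_sum (map pm_free I)))
    (pi : pm_hom (pm_sum (map pm_free I)) M), is_cokernel phi pi.

Definition nonzero (M : pmod) : Prop := ~ pm_iso M pm_zero.

Definition decomposable (M : pmod) : Prop :=
  exists A B : pmod, [/\ nonzero A, nonzero B & pm_iso M (pm_add A B)].

Definition indecomposable (M : pmod) : Prop := nonzero M /\ ~ decomposable M.

Section Shift.
Variables (M : pmod) (r : R).

Lemma pm_shift_map_id a (h : lev a a) (x : M (translate a r)) :
  pm_map M (lev_translate r h) x = x.
Proof. exact: pm_map_id. Qed.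

Lemma pm_shift_map_comp a b c (ab : lev a b) (bc : lev b c) (ac : lev a c)
    (x : M (translate a r)) :
  pm_map M (lev_translate r bc) (pm_map M (lev_translate r ab) x) =
  pm_map M (lev_translate r ac) x.
Proof. exact: pm_map_comp. Qed.

Definition pm_shift : pmod :=
  @PMod (fun a => M (translate a r)) (fun a b ab => pm_map M (lev_translate r ab))
    pm_shift_map_id pm_shift_map_comp.

End Shift.

(* M[e][e] a is M (a + e + e), which is only propositionally M (a + 2 e);
   instead of transporting, eta_(2 e) is taken with values in M[e][e].  The
   inequality h holds for every a because 0 <= e. *)
Definition half_interleaving (M N : pmod) e (f : pm_hom M (pm_shift N e))
    (g : pm_hom N (pm_shift M e)) : Prop :=
  forall a (h : lev a (translate (translate a e) e)) (x : M a),
    g (translate a e) (f a x) = pm_map M h x.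

Definition interleaved (M N : pmod) e : Prop :=
  0 <= e /\ exists (f : pm_hom M (pm_shift N e)) (g : pm_hom N (pm_shift M e)),
    half_interleaving f g /\ half_interleaving g f.

Definition dI (M N : pmod) : \bar R :=
  ereal_inf [set e%:E | e in interleaved M N].

Lemma pm_mapD (M : pmod) a b c (ab : lev a b) (bc : lev b c) x :
  pm_map M bc (pm_map M ab x) = pm_map M (lev_trans ab bc) x.
Proof. exact: pm_map_comp. Qed.

Lemma pm_map_irr (M : pmod) a b (h h' : lev a b) x : pm_map M h x = pm_map M h' x.
Proof. by rewrite (bool_irrelevance h h'). Qed.

Lemma pm_iso_refl M : pm_iso M M.
Proof. by exists (pm_id M), (pm_id M); split=> a x; rewrite comp_lfunE !id_lfunE. Qed.

Lemma pm_iso_sym M N : pm_iso M N -> pm_iso N M.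
Proof. by move=> [f [g [fg gf]]]; exists g, f. Qed.

Lemma pm_iso_trans L M N : pm_iso L M -> pm_iso M N -> pm_iso L N.
Proof.
move=> [f [g [gf fg]]] [f' [g' [gf' fg']]].
exists (pm_comp f' f), (pm_comp g g'); split=> a x; rewrite !comp_lfunE id_lfunE.
- have := gf' a (f a x); rewrite comp_lfunE id_lfunE => ->.
  by have := gf a x; rewrite comp_lfunE id_lfunE.
- have := fg a (g' a x); rewrite comp_lfunE id_lfunE => ->.
  by have := fg' a x; rewrite comp_lfunE id_lfunE.
Qed.

Lemma interleaved_sym M N e : interleaved M N e -> interleaved N M e.
Proof. by move=> [e0 [f [g [fg gf]]]]; split=> //; exists g, f. Qed.

Lemma interleaved_iso M N : pm_iso M N -> interleaved M N 0.
Proof.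
have h0 a : lev a (translate a 0) by exact: lev_translater.
suff K (L L' : pmod) (f : pm_hom L L') : exists F : pm_hom L (pm_shift L' 0),
    forall a x, F a x = pm_map L' (h0 a) (f a x).
  move=> [f [g [gf fg]]]; split=> //.
  have [F FE] := K _ _ f; have [G GE] := K _ _ g.
  exists F, G; split=> a h x; rewrite FE GE pm_nat.
    have := gf a x; rewrite comp_lfunE id_lfunE => ->.
    exact: (pm_map_comp (h0 a) (h0 (translate a 0)) h).
  have := fg a x; rewrite comp_lfunE id_lfunE => ->.
  exact: (pm_map_comp (h0 a) (h0 (translate a 0)) h).
have nat a b (ab : lev a b) x :
    (pm_map L' (h0 b) \o f b)%VF (pm_map L ab x) =
    pm_map (pm_shift L' 0) ab ((pm_map L' (h0 a) \o f a)%VF x).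
  by rewrite !comp_lfunE pm_nat /= !pm_mapD; exact: pm_map_irr.
by exists (@PMHom L (pm_shift L' 0) _ nat) => a x; rewrite comp_lfunE.
Qed.

Lemma interleaved_trans L M N e1 e2 :
  interleaved L M e1 -> interleaved M N e2 -> interleaved L N (e1 + e2).
Proof.
have K (X Y Z : pmod) r e s (h : forall a, lev (translate (translate a r) e)
      (translate a s)) (f : pm_hom X (pm_shift Y r))
    (g : pm_hom Y (pm_shift Z e)) :
    exists F : pm_hom X (pm_shift Z s),
      forall a x, F a x = pm_map Z (h a) (g (translate a r) (f a x)).
  have nat a b (ab : lev a b) x :
      (pm_map Z (h b) \o (g (translate b r) \o f b))%VF (pm_map X ab x) =
      pm_map (pm_shift Z s) ab
        ((pm_map Z (h a) \o (g (translate a r) \o f a))%VF x).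
    rewrite !comp_lfunE (pm_nat f) (pm_nat g) /= !pm_mapD.
    exact: pm_map_irr.
  by exists (@PMHom X (pm_shift Z s) _ nat) => a x; rewrite !comp_lfunE.
have H (X Y Z : pmod) r e (r0 : 0 <= r) (e0 : 0 <= e)
    (h1 : forall a, lev (translate (translate a r) e) (translate a (e1 + e2)))
    (h2 : forall a, lev (translate (translate a e) r) (translate a (e1 + e2)))
    (f : pm_hom X (pm_shift Y r)) (f' : pm_hom Y (pm_shift X r))
    (g : pm_hom Y (pm_shift Z e)) (g' : pm_hom Z (pm_shift Y e))
    (F : pm_hom X (pm_shift Z (e1 + e2))) (G : pm_hom Z (pm_shift X (e1 + e2))) :
    (forall a x, F a x = pm_map Z (h1 a) (g (translate a r) (f a x))) ->
    (forall a x, G a x = pm_map X (h2 a) (f' (translate a e) (g' a x))) ->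
    half_interleaving f f' -> half_interleaving g g' -> half_interleaving F G.
  move=> FE GE ff gg a h x; rewrite FE (pm_nat G) GE.
  have h3 b : lev b (translate (translate b e) e).
    by rewrite translateD lev_translater// addr_ge0.
  have h4 b : lev b (translate (translate b r) r).
    by rewrite translateD lev_translater// addr_ge0.
  rewrite (gg _ (h3 _)) (pm_nat f') (ff _ (h4 _)) /= !pm_mapD.
  exact: pm_map_irr.
move=> [e10 [f [f' [ff ff']]]] [e20 [g [g' [gg gg']]]].
split; first exact: addr_ge0.
have h1 a : lev (translate (translate a e1) e2) (translate a (e1 + e2)).
  by rewrite translateD lev_refl.
have h2 a : lev (translate (translate a e2) e1) (translate a (e1 + e2)).
  by rewrite translateD addrC lev_refl.
have [F FE] := K _ _ _ _ _ _ h1 f g.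
have [G GE] := K _ _ _ _ _ _ h2 g' f'.
exists F, G; split.
- exact: (H _ _ _ _ _ e10 e20 h1 h2 f f' g g').
- exact: (H _ _ _ _ _ e20 e10 h2 h1 g' g f' f).
Qed.

Lemma dI_refl M : dI M M = 0%E.
Proof.
apply/eqP; rewrite eq_le; apply/andP; split; last first.
  by apply: le_ereal_inf_tmp => _ [e [e0 _] <-]; rewrite lee_fin.
by apply: ereal_inf_lbound; exists 0 => //; exact/interleaved_iso/pm_iso_refl.
Qed.

Lemma dI_sym M N : dI M N = dI N M.
Proof.
rewrite /dI; congr (ereal_inf _); apply/seteqP.
by split=> _ [e eMN <-]; exists e => //; exact: interleaved_sym.
Qed.

Lemma dI_ltP M N e :
  (dI M N < e%:E)%E <-> exists2 d, interleaved M N d & d < e.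
Proof.
split=> [/ereal_inf_lt[_ [d MNd <-]]|[d MNd de]].
  by rewrite lte_fin => de; exists d.
by apply: (@le_lt_trans _ _ d%:E); [apply: ereal_inf_lbound; exists d|
  rewrite lte_fin].
Qed.

Lemma dI_triangle_lt L M N e1 e2 :
  (dI L M < e1%:E)%E -> (dI M N < e2%:E)%E -> (dI L N < (e1 + e2)%:E)%E.
Proof.
move=> /dI_ltP[d1 LM d1e] /dI_ltP[d2 MN d2e]; apply/dI_ltP.
by exists (d1 + d2); [exact: interleaved_trans MN|exact: ltrD].
Qed.

Lemma dI_iso L L' M M' : pm_iso L L' -> pm_iso M M' -> dI L M = dI L' M'.
Proof.
move=> LL MM; rewrite /dI; congr (ereal_inf _); apply/seteqP.
split=> _ [e LMe <-]; exists e => //; rewrite -[e]addr0 -[e + 0]add0r.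
  apply: interleaved_trans (interleaved_iso (pm_iso_sym LL)) _.
  exact: interleaved_trans LMe (interleaved_iso MM).
apply: interleaved_trans (interleaved_iso LL) _.
exact: interleaved_trans LMe (interleaved_iso (pm_iso_sym MM)).
Qed.

Record fpmod := FPMod { fp_val :> pmod; fp_finpres : finpres fp_val }.

(* The isomorphism classes of modules are formed from the modules valued in the
   skeleton of vec with objects the 'rV[k]_d: pmod itself lives in a universe
   too large to carry the eqType structure needed by quotients and topologies.
   By mxfp_surj no isomorphism class is lost. *)
Record mxmod := MxMod {
  mx_dim : 'rV[R]_n -> nat;
  mx_map : forall a b, lev a b -> 'M[k]_(mx_dim a, mx_dim b);
  mx_map_id : forall a (h : lev a a), mx_map h = 1%:M;
  mx_map_comp : forall a b c (ab : lev a b) (bc : lev b c) (ac : lev a c),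
    mx_map ab *m mx_map bc = mx_map ac }.

Section PmodOfMx.
Variable M : mxmod.

Lemma pm_of_mx_id a (h : lev a a) (x : 'rV[k]_(mx_dim M a)) :
  linfun (mulmxr (mx_map M h)) x = x.
Proof. by rewrite lfunE /= mx_map_id mulmx1. Qed.

Lemma pm_of_mx_comp a b c (ab : lev a b) (bc : lev b c) (ac : lev a c)
    (x : 'rV[k]_(mx_dim M a)) :
  linfun (mulmxr (mx_map M bc)) (linfun (mulmxr (mx_map M ab)) x) =
  linfun (mulmxr (mx_map M ac)) x.
Proof. by rewrite !lfunE /= -mulmxA (mx_map_comp M ab bc ac). Qed.

Definition pm_of_mx : pmod :=
  @PMod (fun a => 'rV[k]_(mx_dim M a)) (fun a b ab => linfun (mulmxr (mx_map M ab)))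
    pm_of_mx_id pm_of_mx_comp.

End PmodOfMx.

Record mxfp := MxFP { mxfp_val : mxmod; mxfp_finpres : finpres (pm_of_mx mxfp_val) }.

Definition fp_of_mx (M : mxfp) : fpmod := FPMod (mxfp_finpres M).

Section MxOfPmod.
Import VectorInternalTheory.
Variable M : pmod.

Let mx a b (ab : lev a b) : 'M[k]_(dim (M a), dim (M b)) :=
  lin1_mx (v2r \o pm_map M ab \o r2v).

Let mx_id a (h : lev a a) : mx h = 1%:M.
Proof.
apply/row_matrixP => i; rewrite !rowE /mx mul_rV_lin1 /= pm_map_id r2vK.
by rewrite mulmx1.
Qed.

Let mx_comp a b c (ab : lev a b) (bc : lev b c) (ac : lev a c) :
  mx ab *m mx bc = mx ac.
Proof.
apply/row_matrixP => i; rewrite !rowE mulmxA !mul_rV_lin1 /= v2rK.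
by rewrite (pm_map_comp ab bc ac).
Qed.

Lemma pm_of_mx_surj : exists M' : mxmod, pm_iso (pm_of_mx M') M.
Proof.
pose M' := MxMod mx_id mx_comp; exists M'.
pose f a : 'Hom(pm_of_mx M' a, M a) := linfun (r2v : 'rV_(dim (M a)) -> M a).
pose g a : 'Hom(M a, pm_of_mx M' a) := linfun (v2r : M a -> 'rV_(dim (M a))).
have fE a (x : 'rV_(dim (M a))) : f a x = r2v x by exact: (lfunE r2v).
have gE a x : g a x = v2r x by exact: (lfunE v2r).
have natf a b (ab : lev a b) (x : pm_of_mx M' a) :
    f b (pm_map (pm_of_mx M') ab x) = pm_map M ab (f a x).
  by rewrite !fE lfunE /= mul_rV_lin1 /= v2rK.
have natg a b (ab : lev a b) (x : M a) :
    g b (pm_map M ab x) = pm_map (pm_of_mx M') ab (g a x).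
  by rewrite !gE lfunE /= mul_rV_lin1 /= v2rK.
exists (@PMHom (pm_of_mx M') M _ natf), (@PMHom M (pm_of_mx M') _ natg).
by split=> a x; rewrite comp_lfunE id_lfunE /= fE gE ?v2rK ?r2vK.
Qed.

End MxOfPmod.

Lemma is_cokernel_iso (L M C D : pmod) (phi : pm_hom L M) (pi : pm_hom M C)
    (f : pm_hom C D) (g : pm_hom D C) :
  pm_eq (pm_comp g f) (pm_id C) -> pm_eq (pm_comp f g) (pm_id D) ->
  is_cokernel phi pi -> is_cokernel phi (pm_comp f pi).
Proof.
move=> gf fg [pi0 piu]; split=> [a x|N h /piu[u [uh uu]]].
  by have := pi0 a x; rewrite !comp_lfunE => ->; rewrite linear0.
exists (pm_comp u g); split=> [a x|u' uh' a x].
  rewrite !comp_lfunE; have := gf a (pi a x); rewrite comp_lfunE id_lfunE => ->.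
  by rewrite -(uh a x) comp_lfunE.
have E : pm_eq (pm_comp (pm_comp u' f) pi) h.
  by move=> b y; rewrite -(uh' b y) !comp_lfunE.
have := uu _ E a (g a x); rewrite !comp_lfunE => <-.
by have := fg a x; rewrite comp_lfunE id_lfunE => ->.
Qed.

Lemma finpres_iso (M N : pmod) : pm_iso M N -> finpres M -> finpres N.
Proof.
move=> [f [g [gf fg]]] [I [J [phi [pi piP]]]].
by exists I, J, phi, (pm_comp f pi); exact: is_cokernel_iso gf fg piP.
Qed.

Lemma mxfp_surj (M : fpmod) : exists M' : mxfp, pm_iso (fp_of_mx M') M.
Proof.
have [M' MM'] := pm_of_mx_surj M.
by exists (MxFP (finpres_iso (pm_iso_sym MM') (fp_finpres M))).
Qed.

HB.instance Definition _ := gen_eqMixin mxfp.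
HB.instance Definition _ := gen_choiceMixin mxfp.

Definition mxfp_iso (M N : mxfp) : bool := `[< pm_iso (fp_of_mx M) (fp_of_mx N) >].

Lemma mxfp_iso_refl : reflexive mxfp_iso.
Proof. by move=> M; apply/asboolP; exact: pm_iso_refl. Qed.

Lemma mxfp_iso_sym : symmetric mxfp_iso.
Proof. by move=> M N; apply/asboolP/asboolP; exact: pm_iso_sym. Qed.

Lemma mxfp_iso_trans : transitive mxfp_iso.
Proof.
move=> N L M /asboolP LN /asboolP NM; apply/asboolP.
exact: pm_iso_trans LN NM.
Qed.

Canonical mxfp_iso_equiv :=
  EquivRel mxfp_iso mxfp_iso_refl mxfp_iso_sym mxfp_iso_trans.
Canonical mxfp_iso_equiv_direct := defaultEncModRel mxfp_iso.

Definition fpspace := {eq_quot mxfp_iso}.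

HB.instance Definition _ := Choice.on fpspace.
HB.instance Definition _ := EqQuotient.on fpspace.

Definition iso_class (M : fpmod) : fpspace := \pi_fpspace (projT1 (cid (mxfp_surj M))).

Definition fp_repr (C : fpspace) : fpmod := fp_of_mx (repr C).

Lemma iso_classE (M N : fpmod) : iso_class M = iso_class N <-> pm_iso M N.
Proof.
rewrite /iso_class; case: cid => M' MM'; case: cid => N' NN' /=; split.
  move=> /eqquotP/asboolP MN; apply: (pm_iso_trans (pm_iso_sym MM')).
  exact: pm_iso_trans MN NN'.
move=> MN; apply/eqquotP/asboolP; apply: (pm_iso_trans MM').
exact: pm_iso_trans MN (pm_iso_sym NN').
Qed.

Lemma fp_reprK C : iso_class (fp_repr C) = C.
Proof.
rewrite /iso_class; case: cid => M' MC /=; rewrite -[RHS]reprK.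
by apply/eqquotP/asboolP.
Qed.

Definition fp_dist (C D : fpspace) : \bar R := dI (fp_repr C) (fp_repr D).

Lemma fp_distE (M N : fpmod) : fp_dist (iso_class M) (iso_class N) = dI M N.
Proof. by apply: dI_iso; apply/iso_classE; exact: fp_reprK. Qed.

Definition fp_ball (C : fpspace) (e : R) : set fpspace :=
  [set D | (fp_dist C D < e%:E)%E].

Lemma fp_ball_center C e : 0 < e -> fp_ball C e C.
Proof. by move=> e0; rewrite /fp_ball /= /fp_dist dI_refl lte_fin. Qed.

Lemma fp_ball_sym C D e : fp_ball C e D -> fp_ball D e C.
Proof. by rewrite /fp_ball /= /fp_dist dI_sym. Qed.

Lemma fp_ball_triangle C D E e1 e2 :
  fp_ball C e1 D -> fp_ball D e2 E -> fp_ball C (e1 + e2) E.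
Proof. exact: dI_triangle_lt. Qed.

HB.instance Definition _ := @hasNbhs.Build fpspace (nbhs_ (entourage_ fp_ball)).
HB.instance Definition _ := @Nbhs_isPseudoMetric.Build R fpspace
  _ erefl fp_ball fp_ball_center fp_ball_sym fp_ball_triangle erefl.

Definition indecomposable_classes : set fpspace :=
  [set C | exists2 M : fpmod, indecomposable M & iso_class M = C].

Definition Fdecomposable (F : set fpspace) (M : fpmod) : Prop :=
  exists (m : nat) (X : 'I_m -> fpmod),
    (forall i, F (iso_class (X i))) /\
    pm_iso M (pm_sum [seq fp_val (X i) | i <- enum 'I_m]).

Definition Fdecomposable_classes (F : set fpspace) : set fpspace :=
  [set C | exists2 M : fpmod, Fdecomposable F M & iso_class M = C].

End PersistenceModules.

(* Main.v *)
From HB Require Import structures.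
Require Import Defs.
From mathcomp Require Import all_boot all_order all_algebra.
From mathcomp Require Import all_classical all_reals all_analysis.
From mathcomp Require Import lra.

(** The heart of the matter is that every finitely presentable [M] has, at any
    distance [eps], a finitely presentable neighbour [N] such that every direct
    sum near [N] is [eps]-close to one of its summands.

    Stability: let [N] have generators whose grades are, up to a small slack,
    totally ordered by a rank, none of them involved in a relation close to its
    own grade. A morphism [N -> N[2d]] is then a triangular matrix on the
    generators. If [X] is [d]-interleaved with [N], a summand of [X] gives an
    almost idempotent such matrix, whose diagonal has entries 0 and 1. If
    moreover the diagonal of every such matrix is constant, one summand of [X]
    has diagonal 1, so the complementary projection is nilpotent, and vanishes
    after a shift of size about [d] times the number of generators.

    Density: move each generator [x_i] of [M] slightly, raise the relations of
    [M] by [3 eps], and add for each [i] a generator [z_i] far away in one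
    coordinate direction, with [z_i = x_i] imposed after a delay of order [eps];
    this changes [M] by at most [3 eps]. The relation [x_i = z_i] forces the
    diagonal entries of [x_i] and [z_i] to agree. The elements [x_i - z_i] live
    on thin strips, which overlap far away in a second direction; imposing
    [sum_i (x_i - z_i) = 0] there forces the entries of all [z_i] to agree. This
    is where two parameters are needed. *)

Set Implicit Arguments.
Unset Strict Implicit.
Unset Printing Implicit Defensive.
Import Order.TTheory GRing.Theory Num.Theory.
Local Open Scope ring_scope.

(** * Linear algebra *)

Section LinearAlgebra.
Variable k : fieldType.

Lemma lfun_of_linear (U V : vectType k) (f : U -> V) :
  linear f -> {F : 'Hom(U, V) | F =1 f}.
Proof.
move=> f_lin.
pose f' := HB.pack_for {linear U -> V} f (GRing.isLinear.Build _ _ _ _ f f_lin).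
by exists (linfun f') => x; rewrite lfunE.
Qed.

(** The factor is [f] composed with the pseudo-inverse of [p]: as [p] is onto, [x] and the chosen
    preimage of [p x] differ by an element of the kernel of [p], on which [f] vanishes. *)
Lemma lfun_factor (U V W : vectType k) (p : 'Hom(U, V)) (f : 'Hom(U, W)) :
    (forall y, exists x, p x = y) -> (forall x, p x = 0 -> f x = 0) ->
  {h : 'Hom(V, W) | forall x, h (p x) = f x}.
Proof.
move=> p_surj kerpf; exists (f \o p^-1)%VF => x.
have pK y : p ((p^-1)%VF y) = y.
  by have [z <-] := p_surj y; rewrite limg_lfunVK ?memv_img ?memvf.
rewrite comp_lfunE; apply/eqP; rewrite -subr_eq0 -raddfB; apply/eqP/kerpf.
by rewrite raddfB /= pK subrr.
Qed.

(** The spanning family makes [U] a quotient of the free space on [I]; the second hypothesis says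
    that the map given there by [v] vanishes on the kernel. *)
Lemma lfun_on_span (I : finType) (U V : vectType k) (u : I -> U) (v : I -> V) :
    (forall x, exists c : I -> k, x = \sum_i c i *: u i) ->
    (forall c : I -> k, \sum_i c i *: u i = 0 -> \sum_i c i *: v i = 0) ->
  {f : 'Hom(U, V) | forall i, f (u i) = v i}.
Proof.
move=> span rel.
have lin (W : vectType k) (w : I -> W) :
    linear (fun c : {ffun I -> k^o} => \sum_i c i *: w i).
  move=> a c d; rewrite scaler_sumr -big_split /=.
  by apply: eq_bigr => i _; rewrite !ffunE scalerDl scalerA.
pose lc (W : vectType k) (w : I -> W) := sval (lfun_of_linear (lin W w)).
have lcE (W : vectType k) (w : I -> W) c : lc W w c = \sum_i c i *: w i.
  exact: (svalP (lfun_of_linear (lin W w))).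
have surj y : exists x, lc U u x = y.
  have [c ->] := span y; exists [ffun i => c i]; rewrite lcE.
  by apply: eq_bigr => i _; rewrite ffunE.
have ker x : lc U u x = 0 -> lc V v x = 0.
  by rewrite !lcE; apply: rel.
have [f fE] := lfun_factor surj ker; exists f => i.
have one (W : vectType k) (w : I -> W) :
    lc W w [ffun j => (j == i)%:R] = w i.
  rewrite lcE (bigD1 i) //= ffunE eqxx scale1r big1 ?addr0 // => j /negPf ji.
  by rewrite ffunE ji scale0r.
by rewrite -[in LHS]one fE one.
Qed.

Lemma sum_scale_delta (I : finType) (V : lmodType k) (f : I -> V) i :
  \sum_j (j == i)%:R *: f j = f i.
Proof.
rewrite (bigD1 i) //= eqxx scale1r big1 ?addr0 // => j /negPf ->.
by rewrite scale0r.
Qed.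

(** The quotient is realized as the image of the complementary projection [1 - projv W], whose
    kernel is [W]. *)
Lemma quotient_space (V : vectType k) (W : {vspace V}) :
  {Q : vectType k & {q : 'Hom(V, Q) |
    (forall x, (q x == 0) = (x \in W)) /\ forall y, exists x, q x = y}}.
Proof.
pose P : 'End(V) := (\1 - projv W)%VF.
have PE x : P x = x - projv W x by rewrite add_lfunE opp_lfunE id_lfunE.
pose q : 'Hom(V, subvs_of (limg P)) := (linfun (vsproj (limg P)) \o P)%VF.
have qE x : vsval (q x) = P x.
  by rewrite comp_lfunE lfunE /= vsprojK ?memv_img ?memvf.
exists (subvs_of (limg P)), q; split=> [x|y].
  have -> : (q x == 0) = (P x == 0) by rewrite -qE.
  rewrite PE subr_eq0; apply/eqP/idP => [->|xW]; first exact: memv_proj.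
  by rewrite projv_id.
have /memv_imgP[x _ yE] := subvsP y.
by exists x; apply: val_inj; rewrite /= qE yE.
Qed.

End LinearAlgebra.

(** * Presentations of persistence modules *)

Section Presentations.
Variables (k : fieldType) (R : realType) (n : nat).
Implicit Types (M N X : pmod k R n) (a b : 'rV[R]_n).

(* An element of [M g], recorded by all its images; the junk value 0 outside
   the up-set of [g] avoids transporting along equalities of grades. *)
Definition is_sec M (g : 'rV[R]_n) (x : forall a, M a) : Prop :=
  (forall a b (ab : lev a b), lev g a -> pm_map M ab (x a) = x b) /\
  (forall a, ~~ lev g a -> x a = 0).

(** Matching on [idP] provides the proof of [lev g a] that [pm_map] takes as an argument. *)
Definition sec_of M (g : 'rV[R]_n) (x : M g) a : M a :=
  if @idP (lev g a) is ReflectT ga then pm_map M ga x else 0.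

Lemma sec_ofE M g (x : M g) a (ga : lev g a) : sec_of x a = pm_map M ga x.
Proof. by rewrite /sec_of; case: {-}_ / idP => // h; exact: pm_map_irr. Qed.

Lemma sec_of_diag M g (x : M g) : sec_of x g = x.
Proof. by rewrite (sec_ofE x (lev_refl g)) pm_map_id. Qed.

Lemma sec_of_sec M g (x : M g) : is_sec g (sec_of x).
Proof.
split=> [a b ab ga|a /negP ga]; last by rewrite /sec_of; case: {-}_ / idP.
by rewrite (sec_ofE x ga) (sec_ofE x (lev_trans ga ab)) pm_mapD.
Qed.

Lemma is_sec_hom M N g x (F : pm_hom M N) :
  is_sec g x -> is_sec g (fun a => F a (x a)).
Proof.
move=> [nat out]; split=> [a b ab ga|a ga]; last by rewrite out // linear0.
by rewrite -pm_nat nat.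
Qed.

Section Families.
Variables (M : pmod k R n) (I : finType) (g : I -> 'rV[R]_n).
Variable x : I -> forall a, M a.
Hypothesis xP : forall i, is_sec (g i) (x i).
Implicit Type c : I -> k.

(** A generator not yet born at [a] has the junk value 0 there, so its coefficient is arbitrary;
    masking sets it to 0, as the support conditions below demand. *)
Definition mask a c i := if lev (g i) a then c i else 0.

Lemma maskP a c i : mask a c i != 0 -> lev (g i) a.
Proof. by rewrite /mask; case: ifP => //; rewrite eqxx. Qed.

Lemma sum_mask a c : \sum_i c i *: x i a = \sum_i mask a c i *: x i a.
Proof.
apply: eq_bigr => i _; rewrite /mask; case: ifPn => // gi.
by rewrite (xP i).2 // !scaler0.
Qed.

Lemma map_sum a b (ab : lev a b) c : (forall i, c i != 0 -> lev (g i) a) ->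
  pm_map M ab (\sum_i c i *: x i a) = \sum_i c i *: x i b.
Proof.
move=> ca; rewrite linear_sum; apply: eq_bigr => i _; rewrite linearZ /=.
have [->|ci] := eqVneq (c i) 0; first by rewrite !scale0r.
by rewrite (xP i).1 ?ca.
Qed.

End Families.

(** A presentation in terms of elements and coefficient vectors, without free modules. The support
    condition in [pres_ker] excludes the trivial relations satisfied by junk values. *)
Record is_pres M (I J : finType) (g : I -> 'rV[R]_n) (h : J -> 'rV[R]_n)
    (A : J -> I -> k) (x : I -> forall a, M a) : Prop := IsPres {
  pres_sec : forall i, is_sec (g i) (x i);
  pres_span : forall a y, exists c : I -> k, y = \sum_i c i *: x i a;
  pres_ker : forall a (c : I -> k), (forall i, c i != 0 -> lev (g i) a) ->
    \sum_i c i *: x i a = 0 ->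
    exists2 d : J -> k, (forall j, d j != 0 -> lev (h j) a) &
      forall i, c i = \sum_j d j * A j i;
  pres_rel : forall j a, lev (h j) a -> \sum_i A j i *: x i a = 0;
  pres_le : forall j i, A j i != 0 -> lev (g i) (h j) }.

Section PresHom.
Variables (M : pmod k R n) (I J : finType) (g : I -> 'rV[R]_n).
Variables (h : J -> 'rV[R]_n) (A : J -> I -> k) (x : I -> forall a, M a).
Hypothesis MP : is_pres g h A x.

Lemma pres_span_supp a y : exists2 c : I -> k,
  (forall i, c i != 0 -> lev (g i) a) & y = \sum_i c i *: x i a.
Proof.
have [c ->] := pres_span MP y; exists (mask g a c); first exact: maskP.
exact: (sum_mask (pres_sec MP)).
Qed.

(** Any linear relation among generators at [a] is a combination of presenting relations born before
    [a]; each holds for [y] at its own grade and is transported to [a]. *)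
Lemma pres_hom X (y : I -> forall a, X a) :
    (forall i, is_sec (g i) (y i)) ->
    (forall j, \sum_i A j i *: y i (h j) = 0) ->
  exists F : pm_hom M X, forall i a, F a (x i a) = y i a.
Proof.
move=> yP rel.
have step a (c : I -> k) :
    \sum_i c i *: x i a = 0 -> \sum_i c i *: y i a = 0.
  rewrite (sum_mask (pres_sec MP)) (sum_mask yP).
  move=> /(pres_ker MP (maskP (c := c)))[d dh cd].
  under eq_bigr do rewrite cd scaler_suml; rewrite exchange_big big1 //= => j _.
  under eq_bigr do rewrite -scalerA; rewrite -scaler_sumr.
  have [->|dj] := eqVneq (d j) 0; first by rewrite scale0r.
  by rewrite -(map_sum yP (dh j dj) (pres_le MP (j := j))) rel linear0 scaler0.
pose F a : 'Hom(M a, X a) :=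
  sval (lfun_on_span (pres_span MP (a := a)) (step a)).
have FE a i : F a (x i a) = y i a by rewrite /F; case: lfun_on_span.
have nat a b (ab : lev a b) z : F b (pm_map M ab z) = pm_map X ab (F a z).
  have [c ca ->] := pres_span_supp z.
  rewrite (map_sum (pres_sec MP)) // !linear_sum.
  under eq_bigr do rewrite linearZ /= FE.
  under [in RHS]eq_bigr do rewrite linearZ /= FE.
  by rewrite -[RHS]linear_sum [RHS](map_sum yP).
by exists (@PMHom _ _ _ M X F nat) => i a; exact: FE.
Qed.

End PresHom.

Lemma pm_homS L M N (g : pm_hom M N) (f : pm_hom L M) a y :
  pm_comp g f a y = g a (f a y).
Proof. exact: comp_lfunE. Qed.

(** * Cokernels as pointwise quotients *)

Section Cokernel.
Variables (L M : pmod k R n) (phi : pm_hom L M).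

Let Q a : vectType k := projT1 (quotient_space (limg (phi a))).
Let q a : 'Hom(M a, Q a) := sval (projT2 (quotient_space (limg (phi a)))).

Let q0 a x : (q a x == 0) = (x \in limg (phi a)).
Proof. exact: (svalP (projT2 (quotient_space (limg (phi a))))).1. Qed.

Let q_surj a y : exists x, q a x = y.
Proof. exact: (svalP (projT2 (quotient_space (limg (phi a))))).2. Qed.

Let q_img a b (ab : lev a b) x : q a x = 0 -> (q b \o pm_map M ab)%VF x = 0.
Proof.
move=> /eqP; rewrite q0 comp_lfunE => /memv_imgP[y _ ->].
by apply/eqP; rewrite q0 -pm_nat memv_img ?memvf.
Qed.

Let Qmap a b (ab : lev a b) : 'Hom(Q a, Q b) :=
  sval (lfun_factor (@q_surj a) (q_img ab)).

Let QmapE a b (ab : lev a b) x : Qmap ab (q a x) = q b (pm_map M ab x).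
Proof. by rewrite /Qmap; case: lfun_factor => /= f ->; rewrite comp_lfunE. Qed.

Let Qmap_id a (h : lev a a) y : Qmap h y = y.
Proof. by have [x <-] := q_surj y; rewrite QmapE pm_map_id. Qed.

Let Qmap_comp a b c (ab : lev a b) (bc : lev b c) (ac : lev a c) y :
  Qmap bc (Qmap ab y) = Qmap ac y.
Proof.
by have [x <-] := q_surj y; rewrite !QmapE (pm_map_comp ab bc ac).
Qed.

Lemma cokernel_exists : exists (C : pmod k R n) (pi : pm_hom M C),
  [/\ is_cokernel phi pi, forall a y, exists x, pi a x = y &
      forall a x, pi a x = 0 -> exists y, x = phi a y].
Proof.
pose C := PMod Qmap_id Qmap_comp.
have nat a b (ab : lev a b) x : q b (pm_map M ab x) = pm_map C ab (q a x).
  by rewrite /= QmapE.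
exists C, (@PMHom _ _ _ M C q nat); split=> [|a y|a x /eqP]; last 2 first.
- exact: q_surj.
- by rewrite /= q0 => /memv_imgP[y _ ->]; exists y.
split=> [a x|N f f0].
  by rewrite pm_homS; apply/eqP; rewrite q0 memv_img ?memvf.
have kerf a x : q a x = 0 -> f a x = 0.
  move/eqP; rewrite q0 => /memv_imgP[y _ ->].
  by rewrite -(f0 a y) pm_homS.
pose F a : 'Hom(C a, N a) := sval (lfun_factor (@q_surj a) (kerf a)).
have FE a x : F a (q a x) = f a x by rewrite /F; case: lfun_factor.
have Fnat a b (ab : lev a b) y : F b (pm_map C ab y) = pm_map N ab (F a y).
  by have [x <-] := q_surj y; rewrite -nat !FE pm_nat.
exists (@PMHom _ _ _ C N F Fnat); split=> [a x|F' F'E a y].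
  by rewrite pm_homS /= FE.
by have [x <-] := q_surj y; rewrite /= FE -F'E pm_homS.
Qed.

End Cokernel.

Lemma cokernel_unique L M C D (phi : pm_hom L M) (pi : pm_hom M C)
    (rho : pm_hom M D) :
  is_cokernel phi pi -> is_cokernel phi rho ->
  exists f : pm_hom C D, exists2 g : pm_hom D C,
    pm_eq (pm_comp g f) (pm_id C) /\ pm_eq (pm_comp f g) (pm_id D) &
    pm_eq (pm_comp f pi) rho.
Proof.
move=> [pi0 piu] [rho0 rhou].
have [f [fE _]] := piu _ _ rho0; have [g [gE _]] := rhou _ _ pi0.
have fE' a x : f a (pi a x) = rho a x by rewrite -fE pm_homS.
have gE' a x : g a (rho a x) = pi a x by rewrite -gE pm_homS.
exists f, g => //; split=> a y.
  have [w [_ wu]] := piu _ _ pi0.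
  rewrite (wu (pm_comp g f)) ?(wu (pm_id C)) // => b z.
    by rewrite !pm_homS id_lfunE.
  by rewrite !pm_homS fE' gE'.
have [w [_ wu]] := rhou _ _ rho0.
rewrite (wu (pm_comp f g)) ?(wu (pm_id D)) // => b z.
  by rewrite !pm_homS id_lfunE.
by rewrite !pm_homS gE' fE'.
Qed.

(** The universal property alone says nothing about elements; surjectivity and exactness are
    transported from the pointwise quotient along the isomorphism of cokernels. *)
Lemma cokernel_surj_ker L M C (phi : pm_hom L M) (pi : pm_hom M C) :
  is_cokernel phi pi ->
  (forall a y, exists x, pi a x = y) /\
  (forall a x, pi a x = 0 <-> exists y, x = phi a y).
Proof.
move=> piP; have [D [rho [rhoP rho_surj rho_ker]]] := cokernel_exists phi.
have [f [g [gf fg] fE]] := cokernel_unique piP rhoP.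
have fgK a y : g a (f a y) = y by have := gf a y; rewrite pm_homS id_lfunE.
split=> [a y|a x].
  have [x xy] := rho_surj a (f a y); exists x.
  by rewrite -(fgK a y) -xy -fE pm_homS fgK.
split=> [pix|[y ->]]; last by rewrite -(piP.1 a y) pm_homS.
by apply: rho_ker; rewrite -fE pm_homS pix linear0.
Qed.

End Presentations.

(** * Finite presentability in terms of generators and relations *)

Section FinitePresentations.
Variables (k : fieldType) (R : realType) (n : nat).
Implicit Types (M N X : pmod k R n) (a b : 'rV[R]_n).

Lemma pm_add_mapE M N a b (ab : lev a b) y :
  pm_map (pm_add M N) ab y = (pm_map M ab y.1, pm_map N ab y.2).
Proof. exact: lfunE. Qed.

Lemma sum_pair (U V : vectType k) (I : finType) (c : I -> k) (u : I -> U)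
    (v : I -> V) :
  \sum_i c i *: ((u i, v i) : U * V) = (\sum_i c i *: u i, \sum_i c i *: v i).
Proof. by elim/big_rec3: _ => [|i x y z _ ->]. Qed.

Definition free_gen (g : 'rV[R]_n) a : pm_free k g a := const_mx 1.

Lemma free_gen_sec g : is_sec g (free_gen g).
Proof.
split=> [a b ab ga|a].
  rewrite /= lfunE /= /free_gen; have gb := lev_trans ga ab.
  by rewrite ga gb; apply/rowP => j; rewrite !mxE big_ord1 !mxE mulr1.
by rewrite /free_gen /=; case: (lev g a) => // _; rewrite [LHS]thinmx0.
Qed.

Lemma free_gen_span g a (y : pm_free k g a) :
  exists c : k, y = c *: free_gen g a.
Proof.
rewrite /free_gen; move: y; rewrite /=; case: (lev g a) => y /=.
  by exists (y 0 0); apply/rowP => j; rewrite !mxE mulr1 ord1.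
by exists 0; rewrite [LHS]thinmx0 [RHS]thinmx0.
Qed.

Lemma free_gen_neq0 g a c : lev g a -> c *: free_gen g a = 0 -> c = 0.
Proof.
rewrite /free_gen /= => ->; move=> /rowP/(_ 0).
by rewrite !mxE mulr1.
Qed.

(** The index type [T] stays fixed during the induction on [s]; indices outside [s] get the section
    0. *)
Lemma pm_sum_free (T : finType) (g : T -> 'rV[R]_n) (s : seq T) : uniq s ->
  exists x : T -> forall a, pm_sum (map (@pm_free k R n) (map g s)) a,
  [/\ forall t, is_sec (g t) (x t), forall t a, t \notin s -> x t a = 0,
      forall a y, exists c : T -> k, y = \sum_t c t *: x t a &
      forall a c, (forall t, c t != 0 -> t \in s /\ lev (g t) a) ->
        \sum_t c t *: x t a = 0 -> forall t, c t = 0].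
Proof.
elim: s => [_|t s IH /= /andP[ts us]].
  exists (fun _ _ => 0); split=> // [t|a y|a c cP _ t].
  - by split=> // a b ab _; rewrite linear0.
  - by exists (fun=> 0); rewrite [LHS]thinmx0 [RHS]thinmx0.
  - by apply/eqP; case: eqP => // /eqP/cP[].
have [x [xS x0 xspan xfree]] := IH us.
set S := pm_sum _ in x xS x0 xspan xfree *.
pose u v a : pm_free k (g t) a := if v == t then free_gen (g t) a else 0.
exists (fun v a => (u v a, x v a)); split=> [v|v a|a [y1 y2]|a c cP].
- split=> [a b ab va|a va]; last first.
    rewrite (xS v).2 // /u; case: eqP => // vt.
    by rewrite (free_gen_sec _).2 // -vt.
  rewrite pm_add_mapE (xS v).1 //=; congr pair.
  rewrite /u; case: eqP => [vt|_]; last by rewrite linear0.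
  by have := (free_gen_sec (g t)).1 a b ab; rewrite -vt => ->.
- by rewrite inE negb_or => /andP[/negPf vt vs]; rewrite x0 // /u vt.
- have [c1 ->] := free_gen_span y1; have [c2 ->] := xspan a y2.
  exists (fun v => if v == t then c1 else c2 v); rewrite sum_pair; congr pair.
    rewrite (bigD1 t) //= /u !eqxx big1 ?addr0 // => v /negPf vt.
    by rewrite vt scaler0.
  apply: eq_bigr => v _; case: eqP => // ->; by rewrite x0 // !scaler0.
rewrite sum_pair => -[].
rewrite (bigD1 t) //= {1}/u eqxx big1 ?addr0 => [e1 e2|v /negPf vt]; last first.
  by rewrite /u vt scaler0.
have ct : c t = 0.
  apply/eqP; case: eqP => // /eqP/[dup] /cP[_ ta] /eqP[].
  exact: free_gen_neq0 e1.
apply: xfree e2 => v cv; have [] := cP v cv; rewrite inE; case: eqP => // vt.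
by rewrite vt ct eqxx in cv.
Qed.

Lemma pm_sum_free_pres (T : finType) (g : T -> 'rV[R]_n) :
  exists x : T -> forall a, pm_sum (map (@pm_free k R n) (map g (enum T))) a,
    is_pres g (fun i : 'I_0 => 0) (fun _ _ => 0) x.
Proof.
have [x [xS _ xspan xfree]] := pm_sum_free g (enum_uniq T); exists x.
split=> // [a c ca cx|[]|[]] //; exists (fun=> 0) => [j|i]; first by case: j.
rewrite big_ord0; apply: xfree cx i => i /ca.
by rewrite mem_enum.
Qed.

(** If a combination with coefficients [c] dies in [M], it is the image under [phi] of some
    combination [d] of the [y j]; comparing coefficients in the free module [F] gives [c] as [d]
    times [A]. *)
Lemma pres_of_presentation (T T' : finType) (g : T -> 'rV[R]_n)
    (h : T' -> 'rV[R]_n) M L F (phi : pm_hom L F) (pi : pm_hom F M)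
    (A : T' -> T -> k) (x : T -> forall a, F a) (y : T' -> forall a, L a) :
    is_cokernel phi pi ->
    is_pres g (fun i : 'I_0 => 0) (fun _ _ => 0) x ->
    is_pres h (fun i : 'I_0 => 0) (fun _ _ => 0) y ->
    (forall j i, A j i != 0 -> lev (g i) (h j)) ->
    (forall j, phi (h j) (y j (h j)) = \sum_i A j i *: x i (h j)) ->
  is_pres g h A (fun i a => pi a (x i a)).
Proof.
move=> piP xP yP Ale phiE; have [pi_surj pi_ker] := cokernel_surj_ker piP.
have phiE' j a : lev (h j) a -> phi a (y j a) = \sum_i A j i *: x i a.
  move=> ja; rewrite -((pres_sec yP j).1 _ _ ja (lev_refl _)) pm_nat phiE.
  by rewrite (map_sum (pres_sec xP)) //; exact: Ale.
split=> // [i|a z|a c ca|j a ja].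
- exact: is_sec_hom (pres_sec xP i).
- have [w <-] := pi_surj a z; have [c ->] := pres_span xP w; exists c.
  by rewrite linear_sum; apply: eq_bigr => i _; rewrite linearZ.
- under eq_bigr do rewrite -linearZ; rewrite -linear_sum => /pi_ker[w].
  have [d dS ->] := pres_span_supp yP w; rewrite linear_sum.
  under [in RHS]eq_bigr do rewrite linearZ /=.
  have dE j : d j *: phi a (y j a) = \sum_i (d j * A j i) *: x i a.
    have [->|/dS ja] := eqVneq (d j) 0.
      by rewrite scale0r big1 // => i _; rewrite mul0r scale0r.
    by rewrite phiE' // scaler_sumr; apply: eq_bigr => i _; rewrite scalerA.
  under [in RHS]eq_bigr do rewrite dE; rewrite exchange_big /= => /eqP.
  under [X in _ == X]eq_bigr do rewrite -scaler_suml.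
  rewrite -subr_eq0 -sumrB; under eq_bigr do rewrite -scalerBl.
  move=> /eqP e; exists d => // i; apply/eqP; rewrite -subr_eq0; apply/eqP.
  (* Freeness of [F] applies only to coefficients supported on generators born at [a]. *)
  have supp i' : c i' - \sum_j d j * A j i' != 0 -> lev (g i') a.
    apply: contraNT => ia; apply/eqP; rewrite big1 ?subr0 => [|j _].
      by apply/eqP; apply: contraNT ia; exact: ca.
    apply/eqP; apply: contraNT ia; rewrite mulf_eq0 negb_or => /andP[dj Aj].
    exact: lev_trans (Ale _ _ Aj) (dS _ dj).
  have [d' _ ->] := pres_ker xP supp e; by rewrite big_ord0.
- under eq_bigr do rewrite -linearZ; rewrite -linear_sum.
  by rewrite -phiE' //; have := piP.1 a (y j a); rewrite pm_homS.
Qed.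

Lemma finpres_pres M : finpres M ->
  exists (p q : nat) (g : 'I_p -> 'rV[R]_n) (h : 'I_q -> 'rV[R]_n) A x,
    is_pres (M := M) g h A x.
Proof.
move=> [I [J [phi [pi]]]].
(* Lists of grades are turned into families over ordinals, which allow repeated grades. *)
have E (s : seq 'rV[R]_n) :
    s = map (fun i : 'I_(size s) => s`_i) (enum 'I_(size s)).
  by rewrite -[LHS](mkseq_nth 0) /mkseq -val_enum_ord -map_comp.
move: phi pi; rewrite (E I) (E J) => phi pi piP.
have [x xP] := pm_sum_free_pres (fun i : 'I_(size I) => I`_i).
have [y yP] := pm_sum_free_pres (fun i : 'I_(size J) => J`_i).
have /choice[A AP] (j : 'I_(size J)) : exists c : 'I_(size I) -> k,
    (forall i, c i != 0 -> lev I`_i J`_j) /\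
    phi J`_j (y j J`_j) = \sum_i c i *: x i J`_j.
  by have [c cS cE] := pres_span_supp xP (phi J`_j (y j J`_j)); exists c.
do 5!eexists; exists (fun i a => pi a (x i a)).
by apply: (pres_of_presentation piP xP yP (A := A)) => j; case: (AP j).
Qed.

Lemma pres_finpres (I J : finType) (g : I -> 'rV[R]_n) (h : J -> 'rV[R]_n)
    (A : J -> I -> k) : (forall j i, A j i != 0 -> lev (g i) (h j)) ->
  exists M x, finpres M /\ is_pres (M := M) g h A x.
Proof.
move=> Ale.
have [x xP] := pm_sum_free_pres g; have [y yP] := pm_sum_free_pres h.
set F := pm_sum _ in x xP *; set L := pm_sum _ in y yP *.
pose z j : forall a, F a := sec_of (\sum_i A j i *: x i (h j)).
have zP j : is_sec (h j) (z j) by exact: sec_of_sec.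
have [|phi phiE] := pres_hom yP zP; first by case.
have [C [pi [piP _ _]]] := cokernel_exists phi.
exists C, (fun i a => pi a (x i a)); split.
  by exists (map g (enum I)), (map h (enum J)), phi, pi.
apply: (pres_of_presentation piP xP yP Ale) => j.
by rewrite phiE; exact: sec_of_diag.
Qed.

(** A generator killed at once, in its own grade, does not change the module but makes the set of
    generators nonempty, even when [M] is zero. *)
Lemma pres_add_dummy M (I J : finType) (g : I -> 'rV[R]_n) (h : J -> 'rV[R]_n)
    (A : J -> I -> k) x : is_pres (M := M) g h A x ->
  is_pres (M := M) (fun i : I + unit => if i is inl i then g i else 0)
    (fun j : J + unit => if j is inl j then h j else 0)
    (fun j i => match j, i with
      | inl j, inl i => A j i | inr _, inr _ => 1 | _, _ => 0 end)
    (fun i => if i is inl i then x i else fun=> 0).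
Proof.
move=> xP.
have sumE (T : finType) (V : nmodType) (f : T + unit -> V) :
    \sum_i f i = \sum_i f (inl i) + f (inr tt).
  by rewrite big_sumType /= [X in _ + X](big_pred1 tt) // => -[].
split=> [[i|_]|a y|a c ca|[j|_] a ja|[j|_] [i|_]] //=;
  rewrite ?eqxx ?lev_refl //.
- exact: pres_sec xP i.
- by split=> // a b ab _; rewrite linear0.
- have [c ->] := pres_span xP y.
  exists (fun i => if i is inl i then c i else 0).
  by rewrite sumE scaler0 addr0.
- rewrite sumE scaler0 addr0 => /(pres_ker xP (fun i => ca (inl i)))[d dS cd].
  exists (fun j => if j is inl j then d j else c (inr tt)) => [[j|[]]|[i|[]]].
  + exact: dS.
  + exact: ca.
  + by rewrite sumE mulr0 addr0 cd.
  + by rewrite sumE big1 ?add0r ?mulr1 // => j _; rewrite mulr0.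
- by rewrite sumE scaler0 addr0 (pres_rel xP).
- by rewrite sumE scaler0 addr0 big1 // => i _; rewrite scale0r.
- exact: pres_le xP j i.
Qed.

End FinitePresentations.

(** * Direct summands of modules close to a rigid one *)

Section DirectSums.
Variables (k : fieldType) (R : realType) (n : nat).
Implicit Types (M N X Y : pmod k R n) (a b : 'rV[R]_n).

Lemma pm_add_biproduct M N :
  exists (i1 : pm_hom M (pm_add M N)) (i2 : pm_hom N (pm_add M N))
    (p1 : pm_hom (pm_add M N) M) (p2 : pm_hom (pm_add M N) N),
  forall a, [/\ forall x, i1 a x = (x, 0), forall y, i2 a y = (0, y),
    forall z, p1 a z = z.1 & forall z, p2 a z = z.2].
Proof.
have lin1 a : linear (fun x : M a => (x, 0) : pm_add M N a).
  by move=> c x y; congr pair; rewrite /= scaler0 addr0.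
have lin2 a : linear (fun y : N a => (0, y) : pm_add M N a).
  by move=> c x y; congr pair; rewrite /= scaler0 addr0.
have lin3 a : linear (fun z : pm_add M N a => z.1) by [].
have lin4 a : linear (fun z : pm_add M N a => z.2) by [].
pose i1 a := sval (lfun_of_linear (lin1 a)).
have i1E a x : i1 a x = (x, 0) by exact: (svalP (lfun_of_linear (lin1 a))).
pose i2 a := sval (lfun_of_linear (lin2 a)).
have i2E a x : i2 a x = (0, x) by exact: (svalP (lfun_of_linear (lin2 a))).
pose p1 a := sval (lfun_of_linear (lin3 a)).
have p1E a x : p1 a x = x.1 by exact: (svalP (lfun_of_linear (lin3 a))).
pose p2 a := sval (lfun_of_linear (lin4 a)).
have p2E a x : p2 a x = x.2 by exact: (svalP (lfun_of_linear (lin4 a))).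
have n1 a b (ab : lev a b) x :
    i1 b (pm_map M ab x) = pm_map (pm_add M N) ab (i1 a x).
  by rewrite pm_add_mapE !i1E /= linear0.
have n2 a b (ab : lev a b) x :
    i2 b (pm_map N ab x) = pm_map (pm_add M N) ab (i2 a x).
  by rewrite pm_add_mapE !i2E /= linear0.
have n3 a b (ab : lev a b) x :
    p1 b (pm_map (pm_add M N) ab x) = pm_map M ab (p1 a x).
  by rewrite pm_add_mapE !p1E.
have n4 a b (ab : lev a b) x :
    p2 b (pm_map (pm_add M N) ab x) = pm_map N ab (p2 a x).
  by rewrite pm_add_mapE !p2E.
by exists (PMHom n1), (PMHom n2), (PMHom n3), (PMHom n4).
Qed.

Definition is_retraction X Y (i : pm_hom Y X) (p : pm_hom X Y) : Prop :=
  forall a y, p a (i a y) = y.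

(** Splitting [y] into its components, some component must satisfy [P]. The induction carries only
    the retraction [f g = id], a property that survives restriction to the remaining summands. *)
Lemma retract_summand (T : Type) (F : T -> pmod k R n) (s : seq T) X b (y : X b)
    (P : X b -> Prop) :
    ~ P 0 -> (forall u v, P (u + v) -> P u \/ P v) -> P y ->
    pm_iso X (pm_sum [seq F t | t <- s]) ->
  exists (t : T) (i : pm_hom (F t) X) (p : pm_hom X (F t)),
    is_retraction i p /\ P (i b (p b y)).
Proof.
move=> P0 PD Py [f [g [gf fg]]].
have fK a z : g a (f a z) = z by have := gf a z; rewrite pm_homS id_lfunE.
have gK a z : f a (g a z) = z by have := fg a z; rewrite pm_homS id_lfunE.
have {}Py : P (g b (f b y)) by rewrite fK.
elim: s f g {fK gf fg} gK Py => [|t s IH] /= f g gK Py.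
  by move: Py; rewrite [f b y]thinmx0 linear0 => /P0.
have [i1 [i2 [p1 [p2 E]]]] :=
  pm_add_biproduct (F t) (pm_sum [seq F t | t <- s]).
set S := pm_sum _ in i1 i2 p1 p2 E f g gK Py *.
have i1E a x : i1 a x = (x, 0) by case: (E a).
have i2E a x : i2 a x = (0, x) by case: (E a).
have p1E a x : p1 a x = x.1 by case: (E a).
have p2E a x : p2 a x = x.2 by case: (E a).
have fE : f b y = i1 b (p1 b (f b y)) + i2 b (p2 b (f b y)).
  rewrite i1E i2E p1E p2E; case: (f b y) => u v.
  by congr pair; rewrite /= ?addr0 ?add0r.
move: Py; rewrite fE linearD => /PD[] Py.
  exists t, (pm_comp g i1), (pm_comp p1 f); split; last by rewrite !pm_homS.
  by move=> a z; rewrite !pm_homS gK p1E i1E.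
apply: (IH (pm_comp p2 f) (pm_comp g i2)); last by rewrite !pm_homS.
by move=> a z; rewrite !pm_homS gK p2E i2E.
Qed.

Lemma hom_eta X Y (f : pm_hom X Y) r (r0 : 0 <= r) :
  exists F : pm_hom X (pm_shift Y r), forall a (h : lev a (translate a r)) x,
    F a x = pm_map Y h (f a x).
Proof.
have h0 a : lev a (translate a r) by exact: lev_translater.
have nat a b (ab : lev a b) x :
    (pm_map Y (h0 b) \o f b)%VF (pm_map X ab x) =
    pm_map (pm_shift Y r) ab ((pm_map Y (h0 a) \o f a)%VF x).
  by rewrite !comp_lfunE pm_nat /= !pm_mapD; exact: pm_map_irr.
exists (@PMHom _ _ _ X (pm_shift Y r) _ nat) => a h x.
by rewrite (pm_map_irr h (h0 a)) /= comp_lfunE.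
Qed.

(** Take [p] and [i] followed by structure maps: one composite is exact because [p i = id], the
    other is off by [1 - i p], which dies within [2 e]. *)
Lemma retract_interleaved X Y (i : pm_hom Y X) (p : pm_hom X Y) e : 0 <= e ->
    is_retraction i p ->
    (forall a x (h : lev a (translate (translate a e) e)),
      pm_map X h (x - i a (p a x)) = 0) ->
  interleaved X Y e.
Proof.
move=> e0 ip kill; split=> //.
have [F FE] := hom_eta p e0; have [G GE] := hom_eta i e0.
have h0 a : lev a (translate a e) by exact: lev_translater.
exists F, G; split=> a h x.
  rewrite (FE a (h0 a)) (GE _ (h0 _)) pm_nat pm_mapD.
  have /eqP := kill a x h; rewrite linearB subr_eq0 => /eqP /= ->.
  exact: pm_map_irr.
rewrite (GE a (h0 a)) (FE _ (h0 _)) pm_nat pm_mapD ip /=; exact: pm_map_irr.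
Qed.

End DirectSums.

(** * Modules whose endomorphism matrices are triangular with constant diagonal *)

Section NearIndecomposability.
Variables (k : fieldType) (R : realType) (n : nat).
Implicit Types (M X Y : pmod k R n) (a b : 'rV[R]_n).

Definition twice (d : R) a := translate (translate a d) d.

Lemma twiceE d a i : twice d a 0 i = a 0 i + d + d.
Proof. by rewrite !mxE. Qed.

Lemma lev_twice d a b : lev a b -> lev (twice d a) (twice d b).
Proof. by move=> ab; do 2!apply: lev_translate. Qed.

Lemma lev_twicer d a : 0 <= d -> lev a (twice d a).
Proof. by move=> d0; apply/levP => i; rewrite twiceE; lra. Qed.

Variables (N : pmod k R n) (I J : finType) (g : I -> 'rV[R]_n).
Variables (h : J -> 'rV[R]_n) (A : J -> I -> k) (x : I -> forall a, N a).
Hypothesis NP : is_pres g h A x.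

(** Row [i] of the matrix [E] expresses the image of the generator [x i]. This is a predicate
    because rows are determined only modulo the relations. *)
Definition coefs d (e : pm_hom N (pm_shift (pm_shift N d) d))
    (E : I -> I -> k) :=
  (forall i j, E i j != 0 -> lev (g j) (twice d (g i))) /\
  forall i, e (g i) (x i (g i)) = \sum_j E i j *: x j (twice d (g i)).

Lemma coefs_exists d (e : pm_hom N (pm_shift (pm_shift N d) d)) :
  exists E, coefs e E.
Proof.
have /choice[E EP] i : exists c : I -> k,
    (forall j, c j != 0 -> lev (g j) (twice d (g i))) /\
    e (g i) (x i (g i)) = \sum_j c j *: x j (twice d (g i)).
  have [c cS cE] :=
    pres_span_supp NP (a := twice d (g i)) (e (g i) (x i (g i))).
  by exists c.
by exists E; split=> [i|i]; have [] := EP i.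
Qed.

Lemma coefsE d (e : pm_hom N (pm_shift (pm_shift N d) d)) E a i :
    coefs e E -> lev (g i) a ->
  e a (x i a) = \sum_j E i j *: x j (twice d a).
Proof.
move=> [ES EE] ia.
rewrite -((pres_sec NP i).1 _ _ ia (lev_refl _)) pm_nat EE /=.
by rewrite (map_sum (pres_sec NP)) //; exact: ES.
Qed.

Variables (delta : R) (rho : I -> R) (i0 : I).
Hypothesis ordered : forall i j,
  lev (g j) (translate (g i) (4 * delta)) -> j = i \/ rho j < rho i.
Hypothesis alive : forall r i,
  lev (h r) (translate (g i) (4 * delta)) -> A r i = 0.

(* Applying [c] to the image under [e] of the relation [r]. *)
Lemma coefs_link d (e : pm_hom N (pm_shift (pm_shift N d) d)) E r (c : I -> k) :
    0 <= d <= delta -> coefs e E ->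
    (forall r', lev (h r') (translate (h r) (4 * delta)) ->
      \sum_i A r' i * c i = 0) ->
    (forall i j, A r i != 0 -> c j != 0 ->
      lev (g j) (translate (g i) (4 * delta)) -> i = j) ->
  \sum_i A r i * E i i * c i = 0.
Proof.
move=> /andP[d0 dd] EP active disj.
have tw a : lev (twice d a) (translate a (4 * delta)).
  by apply/levP => l; rewrite !mxE; lra.
have tw0 : lev (h r) (twice d (h r)) by exact: lev_twicer.
(* The row [C], the product of [A r] and [E], represents the image under [e] of the relation [r],
   which is zero; hence [C] is a combination of relations. *)
pose C l := \sum_i A r i * E i l.
have CS l : C l != 0 -> lev (g l) (twice d (h r)).
  apply: contraNT => gl; apply/eqP; rewrite /C big1 // => i _.
  apply/eqP; apply: contraNT gl; rewrite mulf_eq0 negb_or => /andP[Ari Eil].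
  apply: lev_trans (EP.1 _ _ Eil) _; apply: lev_twice.
  exact: pres_le NP _ _ Ari.
have C0 : \sum_l C l *: x l (twice d (h r)) = 0.
  rewrite -[RHS](linear0 (e (h r))) -(pres_rel NP (lev_refl (h r))) linear_sum.
  under eq_bigr do rewrite scaler_suml.
  rewrite exchange_big; apply: eq_bigr => i _; rewrite linearZ /=.
  have [->|Ari] := eqVneq (A r i) 0.
    by rewrite scale0r big1 // => l _; rewrite mul0r scale0r.
  rewrite (coefsE EP (pres_le NP Ari)) scaler_sumr.
  by apply: eq_bigr => l _; rewrite scalerA.
have [D DS CD] := pres_ker NP CS C0.
(* Paired with [c], only the diagonal of [E] survives, by [disj]; on the other hand [C] combines
   relations born near [h r], all annihilated by [c]. *)
transitivity (\sum_l C l * c l).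
  rewrite /C; under [RHS]eq_bigr do rewrite mulr_suml.
  rewrite exchange_big /=; apply: eq_bigr => i _.
  rewrite (bigD1 i) //= big1 ?addr0 // => j ji.
  apply: contraNeq ji; rewrite !mulf_eq0 !negb_or => /andP[/andP[Ari Eij] cj].
  by apply/eqP; rewrite (disj i j) //; exact: lev_trans (EP.1 _ _ Eij) (tw _).
under eq_bigr do rewrite CD mulr_suml; rewrite exchange_big big1 //= => r' _.
under eq_bigr do rewrite -mulrA; rewrite -mulr_sumr.
have [->|/DS hr'] := eqVneq (D r') 0; first by rewrite mul0r.
by rewrite active ?mulr0 //; exact: lev_trans hr' (tw _).
Qed.

Hypothesis rigid : forall d (e : pm_hom N (pm_shift (pm_shift N d) d)) E,
  0 <= d <= delta -> coefs e E -> forall i j, E i i = E j j.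

(** Two expressions differ by a combination of relations born before [a], and by [alive] none of
    these involves the generator [i]. *)
Lemma coef_unique i a (c c' : I -> k) : lev a (translate (g i) (4 * delta)) ->
    (forall j, c j != 0 -> lev (g j) a) ->
    (forall j, c' j != 0 -> lev (g j) a) ->
  \sum_j c j *: x j a = \sum_j c' j *: x j a -> c i = c' i.
Proof.
move=> ai cS cS' /eqP; rewrite -subr_eq0 -sumrB.
under eq_bigr do rewrite -scalerBl; move=> /eqP.
move=> /(pres_ker NP (c := fun j => c j - c' j))[j|d dS cd].
  by have [->|/cS//] := eqVneq (c j) 0; rewrite sub0r oppr_eq0 => /cS'.
apply/eqP; rewrite -subr_eq0 cd big1 // => r _.
have [->|/dS ra] := eqVneq (d r) 0; first by rewrite mul0r.
by rewrite alive ?mulr0 //; exact: lev_trans ra ai.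
Qed.

(** * Summands of a module interleaved with [N] *)

Section Summand.
Variables (d : R) (X : pmod k R n) (f : pm_hom N (pm_shift X d)).
Variable f' : pm_hom X (pm_shift N d).
Hypothesis d0 : 0 <= d <= delta.
Hypotheses (ff : half_interleaving f f') (ff' : half_interleaving f' f).

Let d_ge0 : 0 <= d. Proof. by case/andP: d0. Qed.
Let d_le : d <= delta. Proof. by case/andP: d0. Qed.

Lemma conj_hom (u : pm_hom X X) :
  exists e : pm_hom N (pm_shift (pm_shift N d) d), forall a y,
    e a y = f' (translate a d) (u (translate a d) (f a y)).
Proof.
have nat a b (ab : lev a b) y :
    (f' (translate b d) \o (u (translate b d) \o f b))%VF (pm_map N ab y) =
    pm_map (pm_shift (pm_shift N d) d) ab
      ((f' (translate a d) \o (u (translate a d) \o f a))%VF y).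
  by rewrite !comp_lfunE (pm_nat f) /= (pm_nat u) (pm_nat f').
exists (@PMHom _ _ _ N (pm_shift (pm_shift N d) d) _ nat) => a y.
by rewrite /= !comp_lfunE.
Qed.

(** In [f' u f f' u f] the middle [f f'] is a structure map, so the two copies of [u] merge into
    one. *)
Lemma conj_idem (u : pm_hom X X) (e : pm_hom N (pm_shift (pm_shift N d) d)) :
    (forall a y, u a (u a y) = u a y) ->
    (forall a y, e a y = f' (translate a d) (u (translate a d) (f a y))) ->
  forall a y (h : lev (twice d a) (twice d (twice d a))),
    e (twice d a) (e a y) = pm_map N h (e a y).
Proof.
move=> uu eE a y h'; rewrite !eE.
have h1 : lev (translate a d) (translate (twice d a) d).
  by apply/levP => i; rewrite !mxE; move: d_ge0; lra.
rewrite (ff' h1) (pm_nat u) uu (pm_nat f') /=; exact: pm_map_irr.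
Qed.


(** With zero diagonal, [E] strictly lowers the rank [rho]. By [idem], each further shift by [2 d]
    buys one more application of [e], so the image dies once the ranks are exhausted. *)
Lemma nilpotent_kill (e : pm_hom N (pm_shift (pm_shift N d) d)) E :
    coefs e E -> (forall i, E i i = 0) ->
    (forall a y (h : lev (twice d a) (twice d (twice d a))),
      e (twice d a) (e a y) = pm_map N h (e a y)) ->
  forall a b (ab : lev (twice d a) b) y,
    lev (translate a (2 * d * (#|I|%:R + 1))) b -> pm_map N ab (e a y) = 0.
Proof.
move=> EP E0 idem.
have E_lt i j : E i j != 0 -> rho j < rho i.
  move=> Eij; have [||//] := @ordered i j.
    apply: lev_trans (EP.1 _ _ Eij) _; apply/levP => l; rewrite !mxE.
    by move: d_le d_ge0; lra.
  by move=> ji; rewrite ji E0 eqxx in Eij.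
have kill (s : nat) : forall i a b (ab : lev (twice d a) b),
    (#|[pred j | (rho j < rho i)%R]| < s)%N ->
    lev (translate a (2 * d * s%:R)) b -> pm_map N ab (e a (x i a)) = 0.
  elim: s => // s IH i a b ab lt_s le_b.
  have [ia|ia] := boolP (lev (g i) a); last first.
    by rewrite (pres_sec NP i).2 // !linear0.
  (* With [s = 0] no generator has smaller rank, so row [i] of [E] is zero. Otherwise [s >= 1]
     leaves room for the shift by [4 * d] that a second application of [e] requires. *)
  have [s0|s0] := posnP s.
    have -> : e a (x i a) = 0; last by rewrite linear0.
    rewrite (coefsE EP ia) big1 // => j _.
    have [->|/E_lt ji] := eqVneq (E i j) 0; first by rewrite scale0r.
    by move: lt_s; rewrite s0 ltnS leqn0 => /eqP/card0_eq/(_ j); rewrite inE ji.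
  have s1 : 1 <= s%:R :> R by rewrite ler1n.
  have aa : lev (twice d a) (twice d (twice d a)) by apply: lev_twicer.
  have ab2 : lev (twice d (twice d a)) b.
    apply: lev_trans le_b; apply/levP => l; rewrite !mxE -natr1.
    have := ler_wpM2l d_ge0 s1; lra.
  transitivity (pm_map N ab2 (pm_map N aa (e a (x i a)))).
    by rewrite pm_mapD; exact: pm_map_irr.
  rewrite -idem (coefsE EP ia) !linear_sum big1 // => j _; rewrite !linearZ /=.
  have [->|/E_lt ji] := eqVneq (E i j) 0; first by rewrite scale0r.
  rewrite (IH j (twice d a)) ?scaler0 //.
    apply: leq_trans (proper_card _) _; last exact: lt_s.
    rewrite properE; apply/andP; split.
      by apply/fintype.subsetP => l; rewrite !inE => /lt_trans; apply.
    by apply/fintype.subsetPn; exists j; rewrite !inE ?ltxx.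
  apply: lev_trans le_b; apply/levP => l; rewrite !mxE -natr1; lra.
move=> a b ab y le_b; have [c _ ->] := pres_span_supp NP y.
rewrite !linear_sum big1 // => i _; rewrite !linearZ /=.
rewrite (kill #|I|.+1) ?scaler0 //; first by rewrite ltnS max_card.
by rewrite -[#|_|.+1%:R]natr1.
Qed.

Lemma summand_close (T : Type) (F : T -> pmod k R n) (s : seq T) e0 :
    pm_iso X (pm_sum [seq F t | t <- s]) -> d * (#|I|%:R + 2) <= e0 ->
  exists t, interleaved X (F t) e0.
Proof.
move=> iso le_e0.
pose b0 := translate (g i0) d.
have g0 : lev (g i0) (twice d (g i0)) by exact: lev_twicer.
have tw1 : lev (twice d (g i0)) (translate (g i0) (4 * delta)).
  by apply/levP => l; rewrite !mxE; move: d_le d_ge0; lra.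
have tw2 : lev (twice d (twice d (g i0))) (translate (g i0) (4 * delta)).
  by apply/levP => l; rewrite !mxE; move: d_le d_ge0; lra.
(* [P w] says that the generator [i0] occurs in [f' w]. Uniqueness of that coefficient makes it
   additive, so [P] passes to one of two terms of a sum. *)
pose P (w : X b0) := exists2 c : I -> k,
  forall j, c j != 0 -> lev (g j) (twice d (g i0)) &
  (f' b0 w = \sum_j c j *: x j (twice d (g i0))) /\ c i0 != 0.
have P0 : ~ P 0.
  move=> [c cS [+ /eqP[]]]; rewrite linear0 => cE.
  rewrite (coef_unique tw1 cS (c' := fun=> 0)) //.
    by move=> j; rewrite eqxx.
  by rewrite -cE big1 // => j _; rewrite scale0r.
have PD u v : P (u + v) -> P u \/ P v.
  move=> [c cS [cE c0]].
  have [cu cuS cuE] := pres_span_supp NP (a := twice d (g i0)) (f' b0 u).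
  have [cv cvS cvE] := pres_span_supp NP (a := twice d (g i0)) (f' b0 v).
  have [cu0|cu0] := eqVneq (cu i0) 0; last by left; exists cu.
  right; exists cv => //; split=> //; apply: contra_neq c0 => cv0.
  rewrite (coef_unique tw1 cS (c' := fun j => cu j + cv j)) ?cu0 ?cv0 ?addr0 //.
    move=> j; have [->|/cuS//] := eqVneq (cu j) 0; rewrite add0r; exact: cvS.
  under [RHS]eq_bigr do rewrite scalerDl.
  by rewrite big_split /= -cE linearD /= cuE cvE.
have sum_delta a i : \sum_j (j == i)%:R *: x j a = x i a.
  exact: (sum_scale_delta (fun j => x j a)).
have Py : P (f (g i0) (x i0 (g i0))).
  exists (fun j => (j == i0)%:R) => [j /=|].
    by have [->|] := eqVneq j i0; rewrite ?eqxx.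
  rewrite (ff g0) sum_delta eqxx oner_neq0; split=> //.
  by rewrite (pres_sec NP i0).1 ?lev_refl.
have [t [i [p [ip [c cS [cE c0]]]]]] := retract_summand P0 PD Py iso.
exists t; pose u := pm_comp i p.
have uE a y : u a y = i a (p a y) by rewrite pm_homS.
have uu a y : u a (u a y) = u a y by rewrite !uE ip.
have [e eE] := conj_hom u; have [E EP] := coefs_exists e.
have idem := conj_idem uu eE.
have Ei0 : E i0 i0 != 0.
  rewrite -(coef_unique tw1 cS (EP.1 i0)) //.
  by rewrite -EP.2 eE -cE uE.
(* The matrix of [e] applied twice is the square of [E], whose entry at [i0] is the square of the
   diagonal entry: [E i0 j * E j i0] with [j] other than [i0] would lower the rank around a
   cycle. *)
have E2 : E i0 i0 * E i0 i0 = E i0 i0.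
  have h2 : lev (twice d (g i0)) (twice d (twice d (g i0))).
    exact: lev_twicer.
  rewrite -[RHS](coef_unique tw2
    (c := fun l => \sum_j E i0 j * E j l) (c' := E i0)).
  - rewrite (bigD1 i0) //= big1 ?addr0 // => j ji0.
    have [->|E0j] := eqVneq (E i0 j) 0; first by rewrite mul0r.
    have [->|Ej0] := eqVneq (E j i0) 0; first by rewrite mulr0.
    have lt1 : rho j < rho i0.
      have [|j0|//] := @ordered i0 j; first exact: lev_trans (EP.1 _ _ E0j) tw1.
      by rewrite j0 eqxx in ji0.
    have [|j0|lt2] := @ordered j i0.
    - apply: lev_trans (EP.1 _ _ Ej0) _.
      by apply/levP => l; rewrite !mxE; move: d_le d_ge0; lra.
    - by rewrite j0 eqxx in ji0.
    - by have := lt_trans lt1 lt2; rewrite ltxx.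
  - move=> l; apply: contraNT => l0; rewrite big1 // => j _.
    apply/eqP; apply: contraNT l0; rewrite mulf_eq0 negb_or => /andP[E0j Ejl].
    by apply: lev_trans (EP.1 _ _ Ejl) _; apply: lev_twice; exact: EP.1.
  - by move=> j /EP.1/lev_trans; apply.
  - have := idem (g i0) (x i0 (g i0)) h2.
    rewrite EP.2 (map_sum (pres_sec NP)); last exact: EP.1.
    rewrite linear_sum => <-.
    under eq_bigr do rewrite scaler_suml; rewrite exchange_big /=.
    apply: eq_bigr => j _; rewrite linearZ /=.
    have [->|/(EP.1 _ _) E0j] := eqVneq (E i0 j) 0.
      by rewrite scale0r big1 // => l _; rewrite mul0r scale0r.
    rewrite (coefsE EP) // scaler_sumr.
    by apply: eq_bigr => l _; rewrite scalerA.
(* A nonzero idempotent of a field is 1, and rigidity spreads it along the diagonal. *)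
have E1 j : E j j = 1.
  rewrite (rigid d0 EP j i0); apply: (mulfI Ei0); by rewrite E2 mulr1.
have vnat a b (ab : lev a b) y :
    (\1 - u b)%VF (pm_map X ab y) = pm_map X ab ((\1 - u a)%VF y).
  rewrite !add_lfunE !opp_lfunE !id_lfunE linearB; congr (_ - _).
  exact: (pm_nat u).
pose v : pm_hom X X := @PMHom _ _ _ X X (fun a => \1 - u a)%VF vnat.
have vE a y : v a y = y - u a y by rewrite /= add_lfunE opp_lfunE id_lfunE.
have vv a y : v a (v a y) = v a y by rewrite !vE linearB /= uu subrr subr0.
have [e' e'E] := conj_hom v; have idem' := conj_idem vv e'E.
(* Since [f' f] is a structure map, replacing [u] by [1 - u] replaces [E] by the identity minus
   [E]. *)
have DP : coefs e' (fun i j => (j == i)%:R - E i j).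
  split=> [l j /=|l].
    have [-> _|_] := eqVneq j l; first exact: lev_twicer.
    by rewrite sub0r oppr_eq0; exact: EP.1.
  under eq_bigr do rewrite scalerBl; rewrite sumrB sum_delta -EP.2.
  have gl : lev (g l) (twice d (g l)) by exact: lev_twicer.
  by rewrite e'E eE vE linearB /= (ff gl) (pres_sec NP l).1 ?lev_refl.
have D0 l : (l == l)%:R - E l l = 0 by rewrite eqxx E1 subrr.
have kill := nilpotent_kill DP D0 idem'.
have I0 : 0 <= #|I|%:R :> R by rewrite ler0n.
have dI0 := mulr_ge0 d_ge0 I0.
apply: (retract_interleaved _ ip) => [|a y h']; first by move: d_ge0; lra.
rewrite -uE -vE.
pose a1 := translate a d; pose b1 := translate a1 (2 * d * (#|I|%:R + 1)).
have ab1 : lev (twice d a1) b1.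
  by apply/levP => l; rewrite !mxE; lra.
have h1 : lev a1 (twice d a1) by exact: lev_twicer.
have h2 : lev a (twice d a) by exact: lev_twicer.
have h4 : lev (translate b1 d) (translate (translate a e0) e0).
  by apply/levP => l; rewrite !mxE; move: d_ge0; lra.
have h7 : lev (translate a1 d) (translate (twice d a1) d).
  by apply: lev_translate; exact: lev_twicer.
(* As [e'] is [f' v f], the map [f e' f'] is [v] up to structure maps. The total shift is
   [d + 2 * d * (#|I| + 1) + d], which is at most [2 * e0]. *)
have zero : f b1 (pm_map N ab1 (e' a1 (f' a y))) = 0.
  by rewrite kill ?lev_refl // linear0.
move: zero.
rewrite (pm_nat f) e'E (ff' h7) (ff' h2) (pm_nat v) /= !pm_mapD => zero.
have h5 : lev a (translate b1 d).
  by apply/levP => l; rewrite !mxE; move: d_ge0; lra.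
transitivity (pm_map X h4 (pm_map X h5 (v a y))).
  by rewrite pm_mapD; exact: pm_map_irr.
have -> : pm_map X h5 (v a y) = 0 by rewrite -[RHS]zero; exact: pm_map_irr.
exact: linear0.
Qed.

End Summand.
End NearIndecomposability.

(** * Linking the generators *)

Section Construction.
Variables (k : fieldType) (R : realType) (n : nat).

(** Cutting off outside the up-set of [g1] restores the junk value 0 that a section of grade [g1]
    must have. *)
Lemma trunc_sec (M : pmod k R n) (g0 g1 : 'rV[R]_n) x r :
    is_sec g0 x -> lev g0 (translate g1 r) ->
  is_sec (M := pm_shift M r) g1
    (fun a => if lev g1 a then x (translate a r) else 0).
Proof.
move=> [nat out] g01; split=> [a b ab ga|a /negPf ->//].
rewrite ga (lev_trans ga ab) /= nat //.
by apply: lev_trans g01 _; exact: lev_translate.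
Qed.

Lemma half_interleaving_gen (M N : pmod k R n) (I J : finType) g h
    (A : J -> I -> k) x e (f : pm_hom M (pm_shift N e))
    (f' : pm_hom N (pm_shift M e)) :
    is_pres (M := M) g h A x ->
    (forall i a, lev (g i) a ->
      f' (translate a e) (f a (x i a)) = x i (twice e a)) ->
  0 <= e -> half_interleaving f f'.
Proof.
move=> MP ff e0 a hh y; have [c cS ->] := pres_span_supp MP y.
rewrite !linear_sum; apply: eq_bigr => i _; rewrite !linearZ /=.
have [->|/cS ia] := eqVneq (c i) 0; first by rewrite !scale0r.
by rewrite ff // (pres_sec MP i).1.
Qed.

(** * Grades and relations of the linked module *)

Variables (M : pmod k R n) (I J : finType) (g : I -> 'rV[R]_n).
Variables (h : J -> 'rV[R]_n) (A : J -> I -> k) (x : I -> forall a, M a).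
Hypothesis MP : is_pres g h A x.
Variables (u v : 'I_n) (eps : R) (s : I -> R) (B C c delta : R).
Hypothesis uv : u != v.
Hypothesis eps0 : 0 < eps.
Hypothesis sP : forall i, 0 <= s i <= eps.

Let G i := translate (g i) (s i).
Let y i := G i 0 v.

Hypothesis cP : forall i, - (eps / 8) <= c * y i <= eps / 8.
Hypothesis BP : forall i, G i 0 u + 10 * eps <= B.
Hypothesis CP : forall i l, G i 0 l + 10 * eps <= C.
Hypothesis deltaP : 8 * (4 * delta) < eps.
Hypothesis gap : forall i j, y i < y j ->
  y i + 4 * delta < y j /\ c * y i + 4 * delta < c * y j.
Hypothesis y_inj : injective y.

(* In the coordinates [(u, v)], the generator [inr i] lies in the distant column
   [u = B], slightly below the height [y i] of the generator [inl i]; the small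
   slope [c] makes the generators [inr i] pairwise incomparable. *)
Definition gen_grade (t : I + I) : 'rV[R]_n :=
  match t with
  | inl i => G i
  | inr i => \row_l (if l == u then B - c * y i
                     else if l == v then y i - eps else G i 0 l)
  end.

(** The last relation sits at [u = B + eps / 2], left of the relations equating [inl i] and [inr i]:
    where those hold it would be void. Its other coordinates [C] lie beyond all generators. *)
Definition rel_grade (r : J + I + unit) : 'rV[R]_n :=
  match r with
  | inl (inl j) => translate (h j) (3 * eps)
  | inl (inr i) => \row_l (if l == u then B + eps else G i 0 l)
  | inr _ => \row_l (if l == u then B + eps / 2 else C)
  end.

Definition rel_coef (r : J + I + unit) (t : I + I) : k :=
  match r, t with
  | inl (inl j), inl i => A j i
  | inl (inl j), inr i => 0
  | inl (inr j), inl i => (i == j)%:R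
  | inl (inr j), inr i => - (i == j)%:R
  | inr _, inl i => 1
  | inr _, inr i => -1
  end.

Let vu : (v == u) = false.
Proof. by rewrite eq_sym; exact: negPf. Qed.

Let rE (f : 'I_n -> R) l : (\row_l f l) 0 l = f l.
Proof. by rewrite mxE. Qed.

Let tE (a : 'rV[R]_n) r l : translate a r 0 l = a 0 l + r.
Proof. by rewrite !mxE. Qed.

Let GE i l : G i 0 l = g i 0 l + s i.
Proof. exact: tE. Qed.

Lemma rel_le j i : A j i != 0 -> forall l, g i 0 l <= h j 0 l.
Proof. by move=> Aji; apply/levP; exact: pres_le MP _ _ Aji. Qed.

Lemma rel_coef_le r t : rel_coef r t != 0 -> lev (gen_grade t) (rel_grade r).
Proof.
case: r t => [[j|j]|[]] [i|i] /=; rewrite ?eqxx //.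
- move=> /rel_le gh; apply/levP => l; rewrite !tE.
  by have := gh l; have := sP i; move: eps0; lra.
- have [->|] := eqVneq i j; rewrite ?eqxx // => _; apply/levP => l; rewrite rE.
  by case: eqP => [->|//]; have := BP j; move: eps0; lra.
- have [->|] := eqVneq i j; rewrite ?oppr0 ?eqxx // => _.
  apply/levP => l; rewrite !rE.
  case: eqP => _; first by have := cP j; move: eps0; lra.
  by case: eqP => // ->; move: eps0; rewrite /y; lra.
- move=> _; apply/levP => l; rewrite rE; have := CP i l; have := BP i.
  by case: eqP => [->|_]; move: eps0; lra.
- move=> _; apply/levP => l; rewrite !rE; have := CP i l; have := cP i.
  have := CP i v; rewrite -/(y i).
  by case: eqP => [->|_]; [|case: eqP => [->|_]]; move: eps0; lra.
Qed.

Lemma inr_not_le_inl i j :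
  ~ lev (gen_grade (inr j)) (translate (G i) (4 * delta)).
Proof.
move=> /levP/(_ u); rewrite rE eqxx tE; have := BP i; have := cP j.
by move: eps0 deltaP; lra.
Qed.

Lemma inl_not_le_inr i :
  ~ lev (G i) (translate (gen_grade (inr i)) (4 * delta)).
Proof.
move=> /levP/(_ v); rewrite tE rE vu eqxx -/(y i).
by move: eps0 deltaP; lra.
Qed.

(** As [y] grows, coordinate [v] increases and coordinate [u] decreases; by [gap] the slack cannot
    bridge two different heights. *)
Lemma inr_antichain i j :
  lev (gen_grade (inr j)) (translate (gen_grade (inr i)) (4 * delta)) -> j = i.
Proof.
move=> /levP ji; have := ji u; have := ji v.
rewrite !tE !rE eqxx vu eqxx => jv ju; apply: y_inj.
apply/eqP; rewrite eq_le; apply/andP; split; rewrite leNgt; apply/negP.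
  by move=> /gap[]; lra.
by move=> /gap[]; lra.
Qed.

(** [C] exceeds every [y i], so the distant generators come last; they may be tied because they form
    an antichain. *)
Definition gen_rank (t : I + I) : R := if t is inl i then y i else C.

Lemma gen_ordered t t' :
  lev (gen_grade t') (translate (gen_grade t) (4 * delta)) ->
  t' = t \/ gen_rank t' < gen_rank t.
Proof.
case: t t' => [i|i] [j|j] /=.
- move=> /levP/(_ v); rewrite tE -!/(y _) => ji.
  have [ij|] := leP (y j) (y i); last by move=> /gap[]; lra.
  by move: ij; rewrite le_eqVlt => /orP[/eqP/y_inj ->|]; [left|right].
- by move=> /inr_not_le_inl.
- by move=> _; right; have := CP j v; rewrite -/(y j); move: eps0; lra.
- by move=> /inr_antichain ->; left.
Qed.

(** The relations of [M] come [3 * eps] late, against less than [2 * eps] for [s i] and the slack;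
    the others lie at least [3 * eps / 8] to the right of all generators in direction [u]. *)
Lemma gen_alive r t : lev (rel_grade r) (translate (gen_grade t) (4 * delta)) ->
  rel_coef r t = 0.
Proof.
case: r t => [[j|j]|[]] [i|i] //= /levP => [rt|/(_ u)|/(_ u)|/(_ u)|/(_ u)].
- apply/eqP; apply/negP => /negP/rel_le/(_ v); have := rt v; rewrite !tE.
  by have := sP i; move: eps0 deltaP; lra.
all: rewrite tE !rE eqxx => rt; exfalso; move: rt; have := BP i; have := cP i.
all: by move: eps0 deltaP; lra.
Qed.


(** * Rigidity of the linked module and its distance to [M] *)

Variables (N : pmod k R n) (z : I + I -> forall a, N a).
Hypothesis NP : is_pres gen_grade rel_grade rel_coef z.

Lemma sum_pred1 (f : I -> k) i : \sum_j f j * (j == i)%:R = f i.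
Proof.
rewrite (bigD1 i) //= eqxx mulr1 big1 ?addr0 // => j /negPf ->.
by rewrite mulr0.
Qed.

Lemma diag_inl_inr d (e : pm_hom N (pm_shift (pm_shift N d) d)) E i :
    0 <= d <= delta -> coefs gen_grade z e E ->
  E (inl i) (inl i) = E (inr i) (inr i).
Proof.
move=> dd EP.
(* This functional adds the coefficients of [inl i] and [inr i], so it annihilates every relation
   equating [inl j] and [inr j]; tested on the one for [i], it yields the difference of the two
   diagonal entries. *)
pose c' (t : I + I) : k := match t with inl j | inr j => (j == i)%:R end.
apply/eqP; rewrite -subr_eq0; apply/eqP.
rewrite -[RHS](coefs_link NP (r := inl (inr i)) (c := c') dd EP).
- by rewrite big_sumType /= !sum_pred1 eqxx mulN1r mul1r.
- move=> [[j|j]|[]] /levP act; rewrite big_sumType /= !sum_pred1.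
  + rewrite addr0; apply/eqP; apply/negP => /negP/rel_le/(_ v); have := act v.
    by rewrite !tE rE vu GE; have := sP i; move: eps0 deltaP; lra.
  + by rewrite subrr.
  + exfalso; have := act v; rewrite !tE !rE vu.
    by have := CP i v; move: eps0 deltaP; lra.
- move=> [j|j] [l|l] /=; rewrite ?oppr_eq0.
  + by have [->|] := eqVneq j i; have [->|] := eqVneq l i; rewrite ?eqxx.
  + have [->|] := eqVneq j i; have [->|] := eqVneq l i; rewrite ?eqxx //.
    by move=> _ _ /inr_not_le_inl.
  + have [->|] := eqVneq j i; have [->|] := eqVneq l i; rewrite ?eqxx //.
    by move=> _ _ /inl_not_le_inr.
  + by have [->|] := eqVneq j i; have [->|] := eqVneq l i; rewrite ?eqxx.
Qed.

Lemma diag_inr d (e : pm_hom N (pm_shift (pm_shift N d) d)) E i i' :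
    0 <= d <= delta -> coefs gen_grade z e E ->
  E (inr i) (inr i) = E (inr i') (inr i').
Proof.
move=> dd EP.
(* The difference of the coefficients of [inr i] and [inr i'] annihilates the linking relation and
   the relations of [M]; the remaining ones are born later in direction [u]. *)
pose c' (t : I + I) : k := if t is inr j then (j == i)%:R - (j == i')%:R else 0.
have sumE (f : I -> k) : \sum_j f j * ((j == i)%:R - (j == i')%:R) = f i - f i'.
  by under eq_bigr do rewrite mulrBr; rewrite sumrB !sum_pred1.
apply/eqP; rewrite eq_sym -subr_eq0; apply/eqP.
rewrite -[RHS](coefs_link NP (r := inr tt) (c := c') dd EP).
- rewrite big_sumType /= sumE big1 => [|j _]; last by rewrite mulr0.
  by rewrite add0r !mulN1r opprK addrC.
- move=> [[j|j]|[]] /levP act; rewrite big_sumType /= sumE big1 => [|j' _];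
    rewrite ?mulr0 // add0r ?subrr //.
  exfalso; have := act u; rewrite !tE !rE eqxx.
  by move: eps0 deltaP; lra.
- move=> t [l|l] /=; first by rewrite eqxx.
  case: t => [j|j] _ _ => [/inr_not_le_inl|/inr_antichain ->] //.
Qed.

Lemma linked_rigid d (e : pm_hom N (pm_shift (pm_shift N d) d)) E :
    0 <= d <= delta -> coefs gen_grade z e E ->
  forall t t', E t t = E t' t'.
Proof.
move=> dd EP; suff H t t' : E t t = E (inr t') (inr t').
  by move=> t [] i'; rewrite ?(diag_inl_inr i' dd EP); exact: H.
by case: t => i; rewrite ?(diag_inl_inr i dd EP); exact: diag_inr dd EP.
Qed.

(** Both [inl i] and [inr i] go to [x i], and [x i] goes back to [inl i]. The only discrepancy,
    between [inl i] and [inr i], disappears once the relation equating them is born. *)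
Lemma linked_interleaved : interleaved M N (3 * eps).
Proof.
have e3 : 0 <= 3 * eps by move: eps0; lra.
have gG i : lev (g i) (translate (G i) (3 * eps)).
  by apply/levP => l; rewrite !tE; have := sP i; move: eps0; lra.
have Gg i : lev (G i) (translate (g i) (3 * eps)).
  by apply/levP => l; rewrite !tE; have := sP i; move: eps0; lra.
have gz i : lev (g i) (translate (gen_grade (inr i)) (3 * eps)).
  apply/levP => l; rewrite tE rE; have := BP i; have := cP i; rewrite /y tE.
  have := sP i; case: eqP => [->|_]; last case: eqP => [->|_];
    by move: eps0; rewrite /y ?GE; lra.
pose xx (t : I + I) := match t with inl i | inr i => x i end.
pose gg (t : I + I) := match t with inl i | inr i => g i end.
have xxP t : is_sec (gg t) (xx t) by case: t => i; exact: pres_sec MP i.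
have gen_ge t : lev (gg t) (translate (gen_grade t) (3 * eps)) by case: t.
pose w t a : pm_shift M (3 * eps) a :=
  if lev (gen_grade t) a then xx t (translate a (3 * eps)) else 0.
have [F FE] : exists F : pm_hom N (pm_shift M (3 * eps)),
    forall t a, F a (z t a) = w t a.
  apply: (pres_hom NP) => [t|r]; first exact: trunc_sec (gen_ge t).
  transitivity
    (\sum_t rel_coef r t *: xx t (translate (rel_grade r) (3 * eps))).
    apply: eq_bigr => t _; have [->|/rel_coef_le rt] := eqVneq (rel_coef r t) 0.
      by rewrite !scale0r.
    by rewrite /w rt.
  case: r => [[j|j]|[]]; rewrite big_sumType /=.
  - rewrite [X in _ + X]big1 ?addr0 => [|i _]; last by rewrite scale0r.
    apply: (pres_rel MP); apply/levP => l; rewrite !tE; move: eps0; lra.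
  - by rewrite -big_split big1 //= => i _; rewrite scaleNr subrr.
  - by rewrite -big_split big1 //= => i _; rewrite scaleN1r scale1r subrr.
pose w' i a : pm_shift N (3 * eps) a :=
  if lev (g i) a then z (inl i) (translate a (3 * eps)) else 0.
have [F' F'E] : exists F' : pm_hom M (pm_shift N (3 * eps)),
    forall i a, F' a (x i a) = w' i a.
  apply: (pres_hom MP) => [i|j].
    exact: trunc_sec (pres_sec NP (inl i)) (Gg i).
  rewrite -[RHS](pres_rel NP (lev_refl (rel_grade (inl (inl j))))).
  rewrite big_sumType /=.
  rewrite [X in _ = _ + X]big1 ?addr0 => [|i _]; last by rewrite scale0r.
  apply: eq_bigr => i _.
  have [->|Aji] := eqVneq (A j i) 0; first by rewrite !scale0r.
  by rewrite /w' (pres_le MP Aji).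
have lev3 a b : lev a b -> lev a (translate b (3 * eps)).
  by move=> ab; apply: lev_trans ab _; exact: lev_translater.
split=> //; exists F', F; split.
  apply: (half_interleaving_gen MP) => // i a ia.
  rewrite F'E /w' ia FE /w /=; case: ifPn => // /negP[].
  by apply: lev_trans (Gg i) _; exact: lev_translate.
apply: (half_interleaving_gen NP) => // t a ta.
have gta : lev (gg t) (translate a (3 * eps)).
  by apply: lev_trans (gen_ge t) _; exact: lev_translate.
rewrite FE /w ta; case: t ta gta => i /= ta gta; rewrite F'E /w' gta //.
have /(pres_rel NP) : lev (rel_grade (inl (inr i))) (twice (3 * eps) a).
  move/levP: ta => ta; apply/levP => l; have := ta l; rewrite twiceE !rE.
  have := cP i; case: eqP => [->|_]; first by move: eps0; lra.
  by case: eqP => [->|_]; rewrite /y; move: eps0; lra.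
rewrite big_sumType /= sum_scale_delta.
under eq_bigr do rewrite scaleNr.
by rewrite sumrN sum_scale_delta => /eqP; rewrite subr_eq0 => /eqP.
Qed.

End Construction.

(** * Density *)

Local Open Scope classical_set_scope.

Section Density.
Variables (k : fieldType) (R : realType) (n : nat).

Lemma small_real (s : seq R) :
  exists2 eta : R, 0 < eta & forall x, x \in s -> 0 < x -> eta < x.
Proof.
elim: s => [|x s [eta eta0 IH]]; first by exists 1.
have [x0|x0] := ltP 0 x; last first.
  exists eta => // y; rewrite inE => /orP[/eqP -> /lt_le_trans/(_ x0)|/IH//].
  by rewrite ltxx.
have [lt_x|le_x] := ltP eta x.
  by exists eta => // y; rewrite inE => /orP[/eqP ->|/IH].
exists (x / 2); first by lra.
move=> y; rewrite inE => /orP[/eqP -> _|ys y0]; first by lra.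
by have := IH y ys y0; lra.
Qed.

Lemma fin_bound (T : finType) (f : T -> R) :
  exists2 B, 0 <= B & forall t, `|f t| <= B.
Proof.
exists (\sum_t `|f t|) => [|t]; first by rewrite sumr_ge0.
by rewrite (bigD1 t) //= lerDl sumr_ge0.
Qed.

(** Shift by [eta] times the rank of the index: a collision would force [eta] to equal one of
    finitely many quotients, and [eta] lies below all positive ones. *)
Lemma separating_shifts (I : finType) (y : I -> R) eps : 0 < eps ->
  exists2 s : I -> R, forall i, 0 <= s i <= eps &
    injective (fun i => y i + s i).
Proof.
move=> eps0; pose r (i : I) : R := (enum_rank i)%:R.
have [eta eta0 etaP] := small_real
  (eps / (#|I|%:R + 1) ::
   [seq (y t.2 - y t.1) / (r t.1 - r t.2) | t <- enum {: I * I}]).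
have I0 : 0 <= #|I|%:R :> R by rewrite ler0n.
have eta_le : eta * (#|I|%:R + 1) < eps.
  by rewrite -ltr_pdivlMr ?etaP ?mem_head ?divr_gt0 //; lra.
exists (fun i => eta * r i) => [i|i j /= ij].
  have ri : r i <= #|I|%:R by rewrite ler_nat ltnW.
  have r0 : 0 <= r i by rewrite ler0n.
  have := ler_wpM2l (ltW eta0) ri; have := mulr_ge0 (ltW eta0) r0.
  by move: eta0 eta_le; lra.
apply/eqP; apply: contraT => nij.
have rij : r i - r j != 0.
  by rewrite subr_eq0 eqr_nat (inj_eq val_inj) (inj_eq enum_rank_inj).
have etaE : eta = (y j - y i) / (r i - r j).
  by apply: (mulIf rij); rewrite divfK //; lra.
have := etaP eta; rewrite ltxx eta0; apply=> //.
rewrite inE; apply/orP; right.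
by apply/mapP; exists (i, j); rewrite ?mem_enum.
Qed.

Lemma nearly_indecomposable_dense (M : pmod k R n) eps : (2 <= n)%N ->
    finpres M -> 0 < eps ->
  exists N : fpmod k R n, exists delta : R,
    [/\ 0 < delta, interleaved M N (3 * eps) &
      forall X d (T : Type) (F : T -> pmod k R n) (s : seq T),
        interleaved N X d -> d <= delta ->
        pm_iso X (pm_sum [seq F t | t <- s]) ->
      exists t, interleaved X (F t) eps].
Proof.
move=> n2 /finpres_pres[p [q [g' [h' [A' [x' /pres_add_dummy MP]]]]]] eps0.
move: MP.
set g := (fun i : 'I_p + unit => _); set h := (fun j : 'I_q + unit => _).
set A := (fun j i => _); set x := (fun i => _) => MP.
pose u : 'I_n := Ordinal (ltnW n2); pose v : 'I_n := Ordinal n2.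
have uv : u != v by [].
have [s sP s_inj] := separating_shifts (fun i => g i 0 v) eps0.
pose G i := translate (g i) (s i); pose y i := G i 0 v.
have GE i l : G i 0 l = g i 0 l + s i by rewrite !mxE.
have y_inj : injective y.
  by move=> i j; rewrite /y !GE => /s_inj.
have [Y Y0 YP] := fin_bound y.
(* This slope keeps [c * y i] within [eps / 8]; the [+ 1] guards against [Y = 0]. *)
pose c := eps / 8 / (Y + 1).
have c0 : 0 < c by rewrite !divr_gt0 //; lra.
have cY : c * (Y + 1) = eps / 8 by rewrite /c divfK //; lra.
have cP i : - (eps / 8) <= c * y i <= eps / 8.
  have := YP i; rewrite ler_norml => /andP[y1 y2].
  have := ler_wpM2l (ltW c0) y1; have := ler_wpM2l (ltW c0) y2.
  move: c0 cY; lra.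
have [B0 B00 B0P] := fin_bound (fun t : ('I_p + unit) * 'I_n => G t.1 0 t.2).
have GB i l : G i 0 l <= B0 by have := B0P (i, l); rewrite ler_norml => /andP[].
pose B := B0 + 10 * eps; pose C := B + eps.
have [eta eta0 etaP] := small_real
  [seq y t.2 - y t.1 | t <- enum {: ('I_p + unit) * ('I_p + unit)}].
have I0 : 0 <= #|{: ('I_p + unit) + ('I_p + unit)}|%:R :> R by rewrite ler0n.
set m : R := #|_|%:R in I0.
(* The first two bounds give [gap], the third keeps [4 * delta] below [eps / 8], and the last, with
   [m] the number of generators of the new module, turns the stability estimate into [eps]. *)
have [delta delta0 deltaP] :=
  small_real [:: eta / 4; c * eta / 4; eps / 32; eps / (m + 2)].
have d1 : delta < eta / 4 by rewrite deltaP ?inE ?eqxx //; lra.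
have d2 : delta < c * eta / 4.
  have ce := mulr_gt0 c0 eta0.
  by rewrite deltaP ?inE ?eqxx ?orbT //; lra.
have d3 : delta < eps / 32 by rewrite deltaP ?inE ?eqxx ?orbT //; lra.
have d4 : delta * (m + 2) <= eps.
  by rewrite -ler_pdivlMr ?ltW ?deltaP ?inE ?eqxx ?orbT ?divr_gt0 //; lra.
have gap i j : y i < y j ->
    y i + 4 * delta < y j /\ c * y i + 4 * delta < c * y j.
  move=> ij; have : eta < y j - y i.
    apply: etaP; last by rewrite subr_gt0.
    by apply/mapP; exists (i, j); rewrite ?mem_enum.
  move=> etaij; have := ltr_pM2l c0 eta (y j - y i); rewrite etaij.
  by move=> ceta; split; move: ceta; lra.
have BP i : G i 0 u + 10 * eps <= B by rewrite /B; have := GB i u; lra.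
have CP i l : G i 0 l + 10 * eps <= C by rewrite /C /B; have := GB i l; lra.
have d5 : 8 * (4 * delta) < eps by lra.
have [|N [z [Nfp NP]]] := @pres_finpres k R n _ _ (gen_grade g u v eps s B c)
  (rel_grade g h u eps s B C) (rel_coef A); first by apply: (rel_coef_le MP).
exists (FPMod Nfp), delta; split=> // [|X d T F l].
  by apply: (linked_interleaved MP _ _ _ _ _ NP). 
move=> [d0 [f [f' [ff ff']]]] dle iso.
have dd : 0 <= d <= delta by rewrite d0.
(* The dummy generator serves as the reference index. *)
apply: (summand_close NP (inl (inr tt)) _ _ _ dd ff ff' iso).
- by apply: (@gen_ordered _ _ _ _ u v eps s B C c delta).
- by apply: (gen_alive MP).
- move=> d' e E.
  exact: (linked_rigid MP uv eps0 sP cP BP CP d5 gap y_inj NP).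
- apply: le_trans d4; rewrite ler_wpM2r //; lra.
Qed.

Lemma pm_add_zero (M : pmod k R n) : pm_iso M (pm_add M (pm_zero k R n)).
Proof.
have [i1 [i2 [p1 [p2 E]]]] := pm_add_biproduct M (pm_zero k R n).
exists i1, p1; split=> a z; rewrite pm_homS id_lfunE; have [i1E _ p1E _] := E a.
  by rewrite p1E i1E.
rewrite i1E p1E; case: z => z1 z2; congr pair.
by rewrite [z2]thinmx0.
Qed.

Lemma fp_closureP (S : set (fpspace k R n)) p :
  closure S p <-> forall e, 0 < e -> exists2 q, S q & fp_ball p e q.
Proof.
split=> [Sp e e0|Sp U /nbhs_ballP[e e0 eU]].
  by have [q [Sq pq]] := Sp _ (nbhsx_ballx p e e0); exists q.
by have [q Sq pq] := Sp e e0; exists q; split=> //; exact: eU.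
Qed.

(** Near [p] lies a nearly indecomposable [N], still in the ball where [F]-decomposables are dense;
    one of them close to [N] has a summand, a member of [F], close to it. *)
Lemma Fdecomposable_close (F : set (fpspace k R n)) p eps : (2 <= n)%N ->
    0 < eps -> (closure (Fdecomposable_classes F))^° p ->
  exists2 q, F q & fp_ball p eps q.
Proof.
move=> n2 eps0 /nbhs_ballP[r /= r0 rF].
have rm : 0 < Num.min r eps by rewrite lt_min r0.
have [rmr rme] : Num.min r eps <= r /\ Num.min r eps <= eps.
  by rewrite !ge_min !lexx orbT.
set m := Num.min r eps in rm rmr rme.
have m8 : 0 < m / 8 by lra.
have [N [delta [delta0 MN close]]] :=
  nearly_indecomposable_dense n2 (fp_finpres (fp_repr p)) m8.
have ballN : fp_ball p (m / 2) (iso_class N).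
  rewrite /fp_ball /= -[p]fp_reprK fp_distE; apply/dI_ltP.
  by exists (3 * (m / 8)) => //; lra.
have /rF/fp_closureP : ball p r (iso_class N).
  by apply: (le_ball (e1 := m / 2)) => //; lra.
have dm : 0 < Num.min delta (m / 8) by rewrite lt_min delta0.
move=> /(_ _ dm)[_ [X [l [Y [FY iso]] <-]]].
rewrite /fp_ball /= fp_distE => /dI_ltP[d NX].
rewrite lt_min => /andP[/ltW dd dm8].
have [t XY] := close X d _ (fun i => fp_val (Y i)) _ NX dd iso.
exists (iso_class (Y t)) => //.
(* From [p] to [N] costs [3 * (m / 8)], and each of the steps from [N] to [X] and from [X] to its
   summand at most [m / 8]. *)
suff : ball p (m / 2 + (m / 4 + m / 4)) (iso_class (Y t)).
  by apply: le_ball; lra.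
apply: fp_ball_triangle ballN _.
apply: (@fp_ball_triangle _ _ _ _ (iso_class X)).
  by rewrite /fp_ball /= fp_distE; apply/dI_ltP; exists d => //; lra.
by rewrite /fp_ball /= fp_distE; apply/dI_ltP; exists (m / 8) => //; lra.
Qed.

End Density.

Theorem corollary1p3 (k : fieldType) (R : realType) (n : nat) (hn : (2 <= n)%N)
    (F : set (fpspace k R n)) (hF : F `<=` @indecomposable_classes k R n) :
  interior (closure (Fdecomposable_classes F)) = interior (closure F) /\
  (dense (Fdecomposable_classes F) -> dense F).
Proof.
have sub : (closure (Fdecomposable_classes F))^° `<=` closure F.
  move=> p Fp; apply/fp_closureP => e e0.
  exact: Fdecomposable_close hn e0 Fp.
(* A member of [F] is the direct sum of the one-term family, up to the trailing zero module of
   [pm_sum]. *)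
have FF : F `<=` Fdecomposable_classes F.
  move=> p Fp; exists (fp_repr p); last exact: fp_reprK.
  exists 1, (fun=> fp_repr p); split=> [_|]; first by rewrite fp_reprK.
  rewrite enum_ordSl enum_ord0 /=; exact: pm_add_zero.
split.
  apply/seteqP; split; last exact/interiorS/closureS.
  by rewrite -open_subsetE //; exact: open_interior.
move=> dF O [p Op] oO.
have clF q : closure (Fdecomposable_classes F) q.
  move=> U qU; have [||z [zU zF]] := dF U^°; first by exists q.
    exact: open_interior.
  by exists z; split=> //; exact: interior_subset.
(* Every point is in the closure of the [F]-decomposables, so every point is interior to it. *)
have : closure F p by apply: sub; exact: filterS (fun q _ => clF q) filterT.
by move=> /(_ O (open_nbhs_nbhs (conj oO Op)))[q [Fq Oq]]; exists q.
Qed.
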